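(* The only Banach space with an unconditional basis on which every bilinear form is extendible is $c_0$. That is, if $X$ is an (infinite dimensional) Banach space with an unconditional basis, then every continuous bilinear form on $X\times X$ is extendible if and only if $X$ is isomorphic to $c_0$.
   Context: Banach spaces are real or complex, over the scalar field $\mathbb{K}$, and are infinite dimensional unless otherwise stated. A bilinear form on $X\times Y$ is a scalar-valued continuous bilinear mapping. A bilinear form $T:X\times Y\to\mathbb{K}$ is called extendible if for all Banach spaces $E\supset X$ and $F\supset Y$ (containing $X$ and $Y$ isometrically as subspaces) there exists a continuous bilinear form on $E\times F$ that extends $T$. A bilinear form on $X$ means a bilinear form on $X\times X$. *)

(* Defs.v *)
From HB Require Import structures.
From mathcomp Require Import all_boot all_order all_algebra.
From mathcomp Require Import complex.
From mathcomp Require Import all_classical all_reals all_analysis.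

Set Implicit Arguments.
Unset Strict Implicit.
Unset Printing Implicit Defensive.

Import Order.TTheory GRing.Theory Num.Theory.
Import numFieldNormedType.Exports.

Local Open Scope classical_set_scope.
Local Open Scope ring_scope.

Section BanachNotions.
Variable K : numFieldType.

Definition infinite_dimensional (X : lmodType K) : Prop :=
  forall (n : nat) (v : 'I_n -> X),
    exists x : X, forall a : 'I_n -> K, x <> \sum_(i < n) a i *: v i.

Definition schauder_basis (X : normedModType K) (e : nat -> X) : Prop :=
  forall x : X, exists! a : nat -> K,
    series (fun n => a n *: e n) @ \oo --> x.

Definition unconditionally_convergent (X : normedModType K) (u : nat -> X) :
    Prop :=
  forall s : nat -> nat, bijective s -> cvgn (series (u \o s)).

Definition unconditional_basis (X : normedModType K) (e : nat -> X) : Prop :=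
  schauder_basis e /\
  forall a : nat -> K, cvgn (series (fun n => a n *: e n)) ->
    unconditionally_convergent (fun n => a n *: e n).

Definition continuous_bilinear (X Y : normedModType K)
    (T : {bilinear X -> Y -> K^o}) : Prop :=
  continuous (fun p : X * Y => T p.1 p.2).

Definition isometric (X E : normedModType K) (i : X -> E) : Prop :=
  forall x : X, `|i x| = `|x|.

(* A Banach space containing X isometrically as a subspace is given by a
   linear isometric embedding of X. *)
Definition extendible (X Y : normedModType K)
    (T : {bilinear X -> Y -> K^o}) : Prop :=
  forall (E F : completeNormedModType K)
         (i : {linear X -> E}) (j : {linear Y -> F}),
    isometric i -> isometric j ->
    exists S : {bilinear E -> F -> K^o},
      continuous_bilinear S /\ forall (x : X) (y : Y), S (i x) (j y) = T x y.

Definition isomorphic (X Y : normedModType K) : Prop :=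
  exists (f : {linear X -> Y}) (g : {linear Y -> X}),
    [/\ cancel f g, cancel g f, continuous f & continuous g].

Definition null_seq : {pred nat -> K^o} :=
  fun u => `[< u @ \oo --> (0 : K^o) >].

Lemma null_seq_submod_closed : submod_closed null_seq.
Proof.
split=> [|a u v /asboolP u0 /asboolP v0]; apply/asboolP; first exact: cvg_cst.
have -> : (0 : K^o) = a *: (0 : K^o) + 0 by rewrite scaler0 addr0.
have au := @cvgZl_tmp K K^o _ _ _ a u _ u0.
exact: (@cvgD K K^o _ _ _ _ _ _ _ (au _) v0).
Qed.

HB.instance Definition _ :=
  GRing.isSubmodClosed.Build K (nat -> K^o) null_seq null_seq_submod_closed.

Record c0 := C0 { c0_seq :> nat -> K^o; _ : c0_seq \in null_seq }.

HB.instance Definition _ := [isSub for c0_seq].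
HB.instance Definition _ := [Choice of c0 by <:].
HB.instance Definition _ := [SubChoice_isSubLmodule of c0 by <:].

(* Norms take their values in K, which is only partially ordered when
   K = R[i]; the supremum nevertheless exists, a null sequence having an entry
   of maximal modulus. *)
Definition c0_norm (u : c0) : K := supremum 0 (range (fun n => `|u n|)).

Lemma c0_norm_max (u : c0) :
  exists m, c0_norm u = `|u m| /\ forall n, `|u n| <= `|u m|.
Proof.
have [m um] : exists m, forall n, `|u n| <= `|u m|.
  have [u0|] := pselect (forall n, u n = 0).
    by exists 0%N => n; rewrite !u0.
  move/existsNP=> [p /eqP up].
  have /asboolP/cvgr0_norm_lt/(_ `|u p|) : c0_seq u \in null_seq by case: u {up}.
  rewrite normr_gt0 => /(_ up)[N _ Nu].
  suff [m um] : exists m, forall n, (n < maxn N p.+1)%N -> `|u n| <= `|u m|.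
    exists m => n; have [/um//|] := ltnP n (maxn N p.+1).
    rewrite geq_max => /andP[/Nu/ltW un _]; apply: (le_trans un).
    by apply: um; rewrite leq_max ltnSn orbT.
  elim: (maxn N p.+1) => [|k [m um]]; first by exists 0%N.
  have [ukm|umk] := real_leP (normr_real (u m)) (normr_real (u k)).
    exists k => n; rewrite ltnS leq_eqVlt => /orP[/eqP->//|/um].
    by move/le_trans; apply.
  exists m => n; rewrite ltnS leq_eqVlt => /orP[/eqP->|/um//].
  exact: ltW.
exists m; split => //; rewrite /c0_norm /supremum ifF; last first.
  by apply/negbTE/set0P; exists `|u m|; exists m.
have sm : supremums (range (fun n => `|u n|)) `|u m|.
  split; first by move=> _ [n _ <-].
  by move=> y; apply; exists m.
apply: (@is_subset1_supremums _ _ (range (fun n => `|u n|))) => //.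
exact: xgetI sm.
Qed.

Lemma ler_c0_norm (u : c0) n : `|u n| <= c0_norm u.
Proof. by have [m [->]] := c0_norm_max u. Qed.

Lemma c0_normD (u v : c0) : c0_norm (u + v) <= c0_norm u + c0_norm v.
Proof.
have [m [-> _]] := c0_norm_max (u + v).
by rewrite (le_trans (ler_normD _ _))// lerD// ler_c0_norm.
Qed.

Lemma c0_normZ (l : K) (u : c0) : c0_norm (l *: u) = `|l| * c0_norm u.
Proof.
have [m [um _]] := c0_norm_max (l *: u); have [k [uk _]] := c0_norm_max u.
apply/le_anti/andP; split.
  by rewrite um [leLHS]normrM ler_wpM2l// ler_c0_norm.
by rewrite uk -normrM; exact: (ler_c0_norm (l *: u) k).
Qed.

Lemma c0_norm0_eq0 (u : c0) : c0_norm u = 0 -> u = 0.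
Proof.
move=> u0; apply/val_inj/funext => n; apply/eqP.
by rewrite -normr_le0 -u0 ler_c0_norm.
Qed.

HB.instance Definition _ :=
  @Lmodule_isNormed.Build K c0 c0_norm c0_normD c0_normZ c0_norm0_eq0.

End BanachNotions.

(* Main.v *)
Require Import Defs.
From HB Require Import structures.
From mathcomp Require Import all_boot all_order all_algebra.
From mathcomp Require Import complex.
From mathcomp Require Import all_classical all_reals all_analysis.
From mathcomp Require Import ring lra.

Set Implicit Arguments.
Unset Strict Implicit.
Unset Printing Implicit Defensive.

Import Order.TTheory GRing.Theory Num.Theory.
Import numFieldNormedType.Exports.

Local Open Scope classical_set_scope.
Local Open Scope ring_scope.

(** Let X have an unconditional basis; normalize it to e_n, and let f_n be its
coordinate functionals and U its multiplier constant.

If X is isomorphic to c_0, every bounded form T on X extends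
([isomorphic_c0_extendible]). Hahn-Banach extends the coordinate functionals
to E and F; let P_N z and Q_N w be the elements of X whose first N coordinates
are the extended coordinates of z and w, the others being 0. In c_0 these have
norm at most a constant times that of z, w, so T(P_N z, Q_N w) is bounded in N
and a generalized limit over N is a bounded bilinear form. It restricts to T
because P_N x tends to x for x in X.

Suppose conversely that every bounded form extends. X embeds isometrically
into the bounded functions on its dual ball, and every form T becomes the
restriction of a bounded form on that space. For the latter, Grothendieck's
inequality ([grothendieck_linf]) bounds the sum of the T(x_k, y_k) over any
finite family with sum_k |g(x_k)|^2 <= 1 and sum_k |g(y_k)|^2 <= 1 for all g in
the dual ball. The bound may depend on the extension, but a gliding hump
argument ([uniform_boundedness]) makes it C times the norm of T
([extendible_uniformly_dominated]). The forms with coefficients tau_nm with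
respect to f_n(x) f_m(y) on which this is used are bounded by U^2 for trivial
reasons.

First, |tau_nm| <= |g(e_n)| |g(e_m)| for some g in the dual ball. Let kap be the
supremum over g of sum_{n<N} |g(e_n)|^2, let g nearly attain it and let
a_n = |g(e_n)| <= 1. Sort the a_n in decreasing order, cut them into blocks of
M = 4^k, and let tau be, on each block, a_n a_m times the entries of a Hadamard
matrix H. Pairing e_n with the vectors of the orthonormal system M^(-1/2) H
gives 2^(-k) times the sum over the blocks of (sum of the a_n)^2; as the a_n
decrease, this is at least 2^k (kap/2 - M), while the bound is C U^2 kap. For
2^k >= 4 C U^2 it follows that kap <= 4 M: the sums sum_{n<N} |g(e_n)|^2 are
bounded independently of N and g ([weak_l2_bound]).

Secondly, take the diagonal form sum_n g(e_n) f_n(x) f_n(y), where g norms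
e_0 + ... + e_{N-1}. Pairing each e_n with itself gives exactly the norm of that
sum, and the families e_n are weakly 2-summable by the first step. So the norms
of e_0 + ... + e_{N-1} are bounded ([unit_sums_bounded]), and an unconditional
basis with this property is equivalent to that of c_0 ([isomorphic_c0]).

Both scalar fields are treated at once, through the structure [scalars]. *)

(** * Real-valued absolute values and norms *)

(** The scalar field K seen over R: K = R with [iu] = 0 and [im] = 0, or
K = R[i] with [iu] = 'i. In both cases z = re z + iu * im z, which is what makes
a single treatment possible. *)
Record scalars (R : realType) (K : numFieldType) := Scalars {
  toK : {rmorphism R -> K};
  re : K -> R;
  im : K -> R;
  iu : K;
  reD : {morph re : x y / x + y};
  imD : {morph im : x y / x + y};
  reZ : forall r z, re (toK r * z) = r * re z;
  imZ : forall r z, im (toK r * z) = r * im z;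
  re1 : re 1 = 1;
  im1 : im 1 = 0;
  re_iu : re iu = 0;
  scalarE : forall z, z = toK (re z) + iu * toK (im z);
  norm_scalarE : forall z, `|z| = toK (Num.sqrt (re z ^+ 2 + im z ^+ 2));
  iuE : iu = 0 \/ iu * iu = -1 }.

Definition ab R K (S : scalars R K) (z : K) : R :=
  Num.sqrt (re S z ^+ 2 + im S z ^+ 2).

(** Norms take their values in K, which is only partially ordered in the complex
case; [nm] is the same norm with values in R, where suprema and case analysis
are available. *)
Definition nm R K (S : scalars R K) (V : normedModType K) (x : V) : R :=
  ab S `|x|.

Lemma linear_formE (K : nzRingType) (V : lmodType K) (g : V -> K) :
  (forall a x y, g (a *: x + y) = a * g x + g y) ->
  [/\ g 0 = 0, {morph g : x y / x + y} & forall a x, g (a *: x) = a * g x].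
Proof.
move=> gl; have g0 : g 0 = 0.
  by have := gl (-1) 0 0; rewrite scaler0 addr0 mulN1r addNr.
split=> // [x y|a x]; first by have := gl 1 x y; rewrite scale1r mul1r.
by have := gl a x 0; rewrite g0 !addr0.
Qed.

Section RealNorm.
Variables (R : realType) (K : numFieldType) (S : scalars R K).
Local Notation toK := (toK S).
Local Notation re := (re S).
Local Notation im := (im S).
Local Notation ab := (ab S).
Local Notation nm := (nm S).

Lemma re_toK r : re (toK r) = r.
Proof. by rewrite -[toK r]mulr1 reZ re1 mulr1. Qed.

Lemma im_toK r : im (toK r) = 0.
Proof. by rewrite -[toK r]mulr1 imZ im1 mulr0. Qed.

Lemma toK_inj : injective toK.
Proof. exact: (can_inj re_toK). Qed.

Lemma normK z : `|z| = toK (ab z).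
Proof. exact: norm_scalarE. Qed.

Lemma ab_toK r : ab (toK r) = `|r|.
Proof. by rewrite /ab re_toK im_toK expr0n addr0 sqrtr_sqr. Qed.

Lemma ab_ge0 z : 0 <= ab z.
Proof. exact: sqrtr_ge0. Qed.

Lemma toK_ge0 r : (0 <= toK r) = (0 <= r).
Proof.
have pos s : 0 <= s -> 0 <= toK s.
  by move=> s0; rewrite -(ger0_norm s0) -ab_toK -normK normr_ge0.
apply/idP/idP => [r0|]; last exact: pos.
rewrite leNgt; apply/negP => rN.
have : 0 <= toK (- r) by apply: pos; rewrite oppr_ge0 ltW.
rewrite rmorphN oppr_ge0 => r0'.
have /eqP : toK r = 0 by apply/le_anti; rewrite r0 r0'.
by rewrite -(rmorph0 toK) (inj_eq toK_inj) (lt_eqF rN).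
Qed.

Lemma toK_le r s : (toK r <= toK s) = (r <= s).
Proof. by rewrite -subr_ge0 -rmorphB toK_ge0 subr_ge0. Qed.

Lemma toK_lt r s : (toK r < toK s) = (r < s).
Proof. by rewrite !lt_neqAle toK_le (inj_eq toK_inj). Qed.

Section Norm.
Variable V : normedModType K.
Implicit Types x y : V.

Lemma nmE x : `|x| = toK (nm x).
Proof. by rewrite -[LHS]normr_id normK. Qed.

Lemma nm_ge0 x : 0 <= nm x.
Proof. exact: ab_ge0. Qed.

Lemma nmD x y : nm (x + y) <= nm x + nm y.
Proof. by rewrite -toK_le rmorphD -!nmE ler_normD. Qed.

Lemma nmN x : nm (- x) = nm x.
Proof. by apply: toK_inj; rewrite -!nmE normrN. Qed.

Lemma nmB x y : nm (x - y) <= nm x + nm y.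
Proof. by rewrite -(nmN y) nmD. Qed.

Lemma nm_distC x y : nm (x - y) = nm (y - x).
Proof. by rewrite -nmN opprB. Qed.

Lemma nm_dist3 y x z : nm (x - z) <= nm (x - y) + nm (y - z).
Proof. by rewrite -toK_le rmorphD -!nmE ler_distD. Qed.

Lemma nm0 : nm (0 : V) = 0.
Proof. by apply: toK_inj; rewrite -nmE normr0 rmorph0. Qed.

Lemma nm_eq0 x : nm x = 0 -> x = 0.
Proof. by move=> x0; apply/eqP; rewrite -normr_eq0 nmE x0 rmorph0. Qed.

Lemma nm_gt0 x : x <> 0 -> 0 < nm x.
Proof.
by move=> /eqP x0; rewrite lt_neqAle nm_ge0 andbT eq_sym; apply: contra_neq x0;
    apply: nm_eq0.
Qed.

Lemma nmZ a x : nm (a *: x) = ab a * nm x.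
Proof. by apply: toK_inj; rewrite rmorphM -!nmE -normK normrZ. Qed.

Lemma nm_sum I (r : seq I) (P : pred I) (F : I -> V) :
  nm (\sum_(i <- r | P i) F i) <= \sum_(i <- r | P i) nm (F i).
Proof.
elim/big_ind2: _ => [|x1 x2 y1 y2 h1 h2|//]; first by rewrite nm0.
exact: le_trans (nmD _ _) (lerD _ _).
Qed.

End Norm.

Lemma nm_ab (z : K) : nm (z : K^o) = ab z.
Proof. by apply: toK_inj; rewrite -nmE -normK. Qed.

Lemma abM a b : ab (a * b) = ab a * ab b.
Proof. by apply: toK_inj; rewrite rmorphM -!normK normrM. Qed.

Lemma abD a b : ab (a + b) <= ab a + ab b.
Proof. by rewrite -!nm_ab nmD. Qed.

Lemma abN a : ab (- a) = ab a.
Proof. by rewrite -!nm_ab nmN. Qed.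

Lemma ab0 : ab 0 = 0. Proof. by rewrite -nm_ab nm0. Qed.

Lemma ab1 : ab 1 = 1.
Proof. by rewrite -(rmorph1 toK) ab_toK normr1. Qed.

Lemma ab_eq0 z : ab z = 0 -> z = 0.
Proof. by rewrite -nm_ab => /nm_eq0. Qed.

Lemma ab_gt0 z : z <> 0 -> 0 < ab z.
Proof. by move=> /(@nm_gt0 K^o); rewrite nm_ab. Qed.

Lemma abV z : ab (z^-1) = (ab z)^-1.
Proof. by apply: toK_inj; rewrite fmorphV -!normK normfV. Qed.

Lemma ab_sum I (r : seq I) (P : pred I) (F : I -> K) :
  ab (\sum_(i <- r | P i) F i) <= \sum_(i <- r | P i) ab (F i).
Proof.
rewrite -nm_ab; apply: le_trans (nm_sum _ _ _) _.
by apply: ler_sum => i _; rewrite nm_ab.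
Qed.

Lemma ab_iu : ab (iu S) <= 1.
Proof.
have [->|iu2] := iuE S; first by rewrite ab0.
have : ab (iu S) ^+ 2 = 1 by rewrite expr2 -abM iu2 abN ab1.
by have := ab_ge0 (iu S); nra.
Qed.

Lemma sqr_ab z : ab z ^+ 2 = re z ^+ 2 + im z ^+ 2.
Proof. by rewrite sqr_sqrtr // addr_ge0 // sqr_ge0. Qed.

Lemma re_le_ab z : `|re z| <= ab z.
Proof.
rewrite -(@ler_pXn2r _ 2%N) ?nnegrE ?ab_ge0 // sqr_ab real_normK ?num_real //.
by rewrite lerDl sqr_ge0.
Qed.

Lemma im_le_ab z : `|im z| <= ab z.
Proof.
rewrite -(@ler_pXn2r _ 2%N) ?nnegrE ?ab_ge0 // sqr_ab real_normK ?num_real //.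
by rewrite lerDr sqr_ge0.
Qed.

Lemma ab_le_reim z : ab z <= `|re z| + `|im z|.
Proof.
rewrite {1}(scalarE S z); apply: le_trans (abD _ _) _.
rewrite abM !ab_toK lerD2l; apply: ler_piMl => //; exact: ab_iu.
Qed.

Lemma re0 : re 0 = 0. Proof. by rewrite -(rmorph0 toK) re_toK. Qed.
Lemma im0 : im 0 = 0. Proof. by rewrite -(rmorph0 toK) im_toK. Qed.

Lemma re_sum I (r : seq I) (P : pred I) (F : I -> K) :
  re (\sum_(i <- r | P i) F i) = \sum_(i <- r | P i) re (F i).
Proof. exact: (big_morph re (reD S) re0). Qed.

Lemma im_sum I (r : seq I) (P : pred I) (F : I -> K) :
  im (\sum_(i <- r | P i) F i) = \sum_(i <- r | P i) im (F i).
Proof. exact: (big_morph im (imD S) im0). Qed.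

(** With [cauchy_nm], the gateway through which all topological statements are
turned into inequalities between real numbers. *)
Lemma cvg_nm (V : normedModType K) (u : nat -> V) (l : V) :
  u @ \oo --> l <->
  forall e : R, 0 < e -> exists N, forall n, (N <= n)%N -> nm (u n - l) < e.
Proof.
split=> [/cvgrPdist_lt ul e e0|ul].
  have [|N _ Nu] := ul (toK e); first by rewrite -(rmorph0 toK) toK_lt.
  by exists N => n /Nu; rewrite /= nmE toK_lt nm_distC.
apply/cvgrPdist_lt => e e0.
have eE : e = toK (ab e) by rewrite -normK gtr0_norm.
have [|N Nu] := ul (ab e); first by rewrite -toK_lt rmorph0 -eE.
by exists N => // n /Nu un; rewrite /= nmE eE toK_lt nm_distC.
Qed.

Lemma cauchy_nm (X : completeNormedModType K) (u : nat -> X) :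
  (forall e : R, 0 < e -> exists N, forall n, (N <= n)%N -> nm (u n - u N) < e) ->
  cvgn u.
Proof.
move=> cu; apply: cauchy_cvg; apply: cauchy_exP => e e0.
have eE : e = toK (ab e) by rewrite -normK gtr0_norm.
have [|N Nu] := cu (ab e); first by rewrite -toK_lt rmorph0 -eE.
exists (u N); exists N => // n /Nu un /=.
by rewrite -ball_normE /ball_ /= eE nmE toK_lt nm_distC.
Qed.

Lemma cvgn_cauchy_nm (V : normedModType K) (u : nat -> V) :
  cvgn u -> forall e : R, 0 < e ->
  exists N, forall m n, (N <= m)%N -> (N <= n)%N -> nm (u m - u n) < e.
Proof.
move=> /cvg_nm ul e e0; have [|N Nu] := ul (e / 2); first by rewrite divr_gt0.
exists N => m n /Nu um /Nu un.
rewrite (le_lt_trans (nm_dist3 (limn u) _ _)) //.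
by rewrite [ltRHS]splitr ltrD // nm_distC.
Qed.

End RealNorm.

Section UltraLimit.
Variables (R : realType) (K : numFieldType) (S : scalars R K).
Local Notation ab := (ab S).

Definition bounded_seq (u : nat -> K) := exists B, forall n, ab (u n) <= B.

(** By compactness, the image of the ultrafilter has a cluster point; being an
ultrafilter, it contains every neighbourhood of it. *)
Lemma real_ultralimit (U : set_system nat) (v : nat -> R) (B : R) :
  UltraFilter U -> (forall n, `|v n| <= B) ->
  exists l, forall e, 0 < e -> U [set n | `|v n - l| < e].
Proof.
move=> UU vB; have [|l [_ vl]] := @segment_compact R (- B) B (v @ U) _.
  apply: (@filterS _ U _ setT) filterT => n _ /=.
  by rewrite in_itv /= -ler_norml.
exists l => e e0.
have [//|nU] := in_ultra_setVsetC [set n | `|v n - l| < e] UU.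
have nU' : (v @ U) (~` ball l e).
  apply: (@filterS _ U _ _ _ _ nU) => n /=.
  by rewrite -ball_normE /ball_ /= distrC.
have [x [/= xN xl]] := vl (~` ball l e) _ nU' (nbhsx_ballx l e e0).
by case: xN.
Qed.

(** A limit along an ultrafilter. The second property says that closed balls
containing the tail of the sequence contain the limit: so norm bounds pass to
the limit, and convergent sequences have their usual limit. *)
Lemma generalized_limit : exists LIM : (nat -> K) -> K,
  (forall a u v, bounded_seq u -> bounded_seq v ->
     LIM (fun n => a * u n + v n) = a * LIM u + LIM v) /\
  (forall u c e N, bounded_seq u ->
     (forall n, (N <= n)%N -> ab (u n - c) <= e) -> ab (LIM u - c) <= e).
Proof.
have [U [UU sU]] := ultraFilterLemma eventually_filter.
pose isL (u : nat -> K) (l : K) := forall e, 0 < e -> U [set n | ab (u n - l) < e].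
have exL u : bounded_seq u -> exists l, isL u l.
  move=> [B uB].
  have [l1 h1] : exists l, forall e, 0 < e -> U [set n | `|re S (u n) - l| < e].
    by apply: real_ultralimit => n; exact: le_trans (re_le_ab _ _) (uB n).
  have [l2 h2] : exists l, forall e, 0 < e -> U [set n | `|im S (u n) - l| < e].
    by apply: real_ultralimit => n; exact: le_trans (im_le_ab _ _) (uB n).
  exists (toK S l1 + iu S * toK S l2) => e e0.
  have e2 : 0 < e / 2 by rewrite divr_gt0.
  apply: filterS (filterI (h1 _ e2) (h2 _ e2)) => n /= [n1 n2].
  rewrite {1}(scalarE S (u n)) opprD addrACA -mulrBr -!rmorphB /=.
  apply: le_lt_trans (abD _ _ _) _; rewrite abM !ab_toK [ltRHS]splitr.
  apply: ltr_leD => //; apply: le_trans (ltW n2).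
  by apply: ler_piMl => //; exact: ab_iu.
have uniqL u c l e : U [set n | ab (u n - c) <= e] -> isL u l -> ab (l - c) <= e.
  move=> uc ul; apply/ler_addgt0Pr => d d0.
  have [n [/= n1 n2]] := filter_ex (filterI uc (ul d d0)).
  have -> : l - c = (u n - c) - (u n - l) by ring.
  by apply: le_trans (abD _ _ _) _; rewrite abN lerD // ltW.
pose LIM u := xget 0 (isL u).
have limP u : bounded_seq u -> isL u (LIM u).
  by move=> /exL[l ul]; exact: (xgetI 0 ul).
exists LIM; split=> [a u v bu bv|u c e N bu h].
  have bw : bounded_seq (fun n => a * u n + v n).
    move: bu bv => [B uB] [C vC]; exists (ab a * B + C) => n.
    apply: le_trans (abD _ _ _) _.
    by rewrite abM lerD // ler_wpM2l // ab_ge0.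
  apply/eqP; rewrite -subr_eq0; apply/eqP/(@ab_eq0 _ _ S)/le_anti.
  rewrite ab_ge0 andbT; apply/ler_addgt0Pr => d d0; rewrite add0r.
  apply: uniqL (limP _ bw).
  have d2 : 0 < d / 2 / (1 + ab a) by rewrite !divr_gt0 // ltr_pwDl // ab_ge0.
  have d3 : 0 < d / 2 by rewrite divr_gt0.
  apply: filterS (filterI (limP _ bu _ d2) (limP _ bv _ d3)) => n /= [n1 n2].
  have -> : a * u n + v n - (a * LIM u + LIM v) =
    a * (u n - LIM u) + (v n - LIM v) by ring.
  apply: le_trans (abD _ _ _) _; rewrite [leRHS]splitr abM; apply: lerD; last
      exact: ltW.
  have a0 := ab_ge0 S a; move: n1; rewrite ltr_pdivlMr; last by rewrite ltr_pwDl.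
  by have := ab_ge0 S (u n - LIM u); nra.
apply: uniqL (limP _ bu); apply: sU; exists N => // n /= Nn; exact: h.
Qed.

End UltraLimit.

(** * Bounded bilinear forms and a uniform boundedness principle *)

Section BoundedForms.
Variables (R : realType) (K : numFieldType) (S : scalars R K).
Local Notation toK := (toK S).
Local Notation ab := (ab S).
Local Notation nm := (nm S).

(** The limit is the generalized limit, which stays in each of the balls that
the Cauchy property provides. *)
Lemma scalar_complete (u : nat -> K) :
  (forall e, 0 < e -> exists N, forall n, (N <= n)%N -> ab (u n - u N) <= e) ->
  exists l, forall e, 0 < e -> exists N, forall n, (N <= n)%N -> ab (u n - l) <= e.
Proof.
move=> cu; have [LIM [_ limP]] := generalized_limit S.
have bu : bounded_seq S u.
  have [N Nu] := cu 1 ltr01.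
  exists (1 + ab (u N) + \sum_(i < N) ab (u i)) => n.
  have s0 (P : pred 'I_N) : 0 <= \sum_(i < N | P i) ab (u i).
    by apply: sumr_ge0 => i _; exact: ab_ge0.
  have [Nn|nN] := leqP N n.
    rewrite -[u n](subrK (u N)); apply: le_trans (abD _ _ _) _.
    by rewrite -[leLHS]addr0 !lerD // Nu.
  rewrite (bigD1 (Ordinal nN)) //= addrCA lerDl addr_ge0 ?s0 //.
  by rewrite addr_ge0 // ab_ge0.
exists (LIM u) => e e0; have [|N Nu] := cu (e / 2); first by rewrite divr_gt0.
exists N => n Nn; have -> : u n - LIM u = (u n - u N) - (LIM u - u N) by ring.
apply: le_trans (abD _ _ _) _; rewrite abN [leRHS]splitr lerD ?Nu //.
exact: limP Nu.
Qed.

Lemma nbhs_nm (V : normedModType K) (x : V) (A : set V) :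
  nbhs x A <-> exists2 d : R, 0 < d & forall y, nm (x - y) < d -> A y.
Proof.
split=> [/nbhs_ballP[e /= e0 eA]|[d d0 dA]].
  have eE : e = toK (ab e) by rewrite -normK gtr0_norm.
  exists (ab e) => [|y xy]; first by rewrite -(toK_lt S) rmorph0 -eE.
  by apply: eA; rewrite -ball_normE /ball_ /= (nmE S) eE toK_lt.
apply/nbhs_ballP; exists (toK d); first by rewrite /= -(rmorph0 toK) toK_lt.
by move=> y; rewrite -ball_normE /ball_ /= (nmE S) toK_lt => /dA.
Qed.

Lemma continuous_nm (V W : normedModType K) (f : V -> W) : continuous f <->
  forall x (e : R), 0 < e ->
  exists2 d : R, 0 < d & forall y, nm (x - y) < d -> nm (f x - f y) < e.
Proof.
split=> [cf x e e0|h x A /nbhs_nm[e e0 eA]].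
  have /nbhs_nm[d d0 hd] : nbhs x (f @^-1` [set z | nm (f x - z) < e]).
    by apply: (cf x); apply/nbhs_nm; exists e.
  by exists d.
have [d d0 hd] := h x e e0.
by apply/nbhs_nm; exists d => // y /hd /eA.
Qed.

(** The usual rescaling argument. It is stated for a homogeneous function rather
than for the norm of a linear map so that it applies twice to a bilinear form,
once in each variable. *)
Lemma bounded_of_local (V : normedModType K) (p : V -> R) (d : R) :
  0 < d -> (forall r x, 0 <= r -> p (toK r *: x) = r * p x) ->
  (forall x, nm x < d -> p x <= 1) -> forall x, p x <= 2 / d * nm x.
Proof.
move=> d0 pZ p1 x; have [->|/eqP x0] := eqVneq x 0.
  have := pZ 0 0 (lexx 0); rewrite scaler0 mul0r => ->.
  by rewrite nm0 mulr0.
have nx := nm_gt0 S x0.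
have r0 : 0 < d / 2 / nm x by rewrite !divr_gt0.
have := p1 (toK (d / 2 / nm x) *: x).
rewrite nmZ ab_toK gtr0_norm // divfK ?gt_eqF // pZ; last exact: ltW.
rewrite ltr_pdivrMr // ltr_pMr // ltr1n => /(_ isT).
rewrite -ler_pdivlMl // => h; apply: le_trans h _.
by rewrite le_eqVlt; apply/orP; left; apply/eqP; field; rewrite !gt_eqF.
Qed.

Lemma continuous_linear_bounded_nm (V W : normedModType K)
    (f : {linear V -> W}) :
  continuous f -> exists2 c, 0 <= c & forall x, nm (f x) <= c * nm x.
Proof.
move=> /continuous_nm/(_ 0 1 ltr01)[d d0 hd]; exists (2 / d).
  by rewrite divr_ge0 // ltW.
apply: bounded_of_local => // [r x r0|x xd].
  by rewrite linearZ nmZ ab_toK ger0_norm.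
have := hd x; rewrite linear0 !sub0r !nmN => /(_ xd).
exact: ltW.
Qed.

Lemma linear_bounded_continuous_nm (V W : normedModType K)
    (f : {linear V -> W}) c :
  (forall x, nm (f x) <= c * nm x) -> continuous f.
Proof.
move=> fc; apply/continuous_nm => x e e0; exists (e / (1 + `|c|)).
  by rewrite divr_gt0 // ltr_pwDl.
move=> y; rewrite ltr_pdivlMr ?ltr_pwDl // -linearB.
apply: le_lt_trans; apply: le_trans (fc _) _; rewrite mulrC.
rewrite ler_wpM2l ?nm_ge0 //; apply: le_trans (ler_norm c) _.
by rewrite lerDr.
Qed.

(** Bounded bilinear forms as plain functions: forms given by formulas or as
limits can be handled before they are packed into the bilinear structure. *)
Definition bform (V W : normedModType K) (c : R) (T : V -> W -> K) :=
  [/\ forall a x x' y, T (a *: x + x') y = a * T x y + T x' y,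
      forall a x y y', T x (a *: y + y') = a * T x y + T x y' &
      forall x y, ab (T x y) <= c * nm x * nm y].

Section Forms.
Variables V W : normedModType K.

Lemma bform_continuous c (T : V -> W -> K) : bform c T ->
  exists T' : {bilinear V -> W -> K^o},
    continuous_bilinear T' /\ forall x y, T' x y = T x y.
Proof.
move=> [Tl Tr Tc].
have Tb : bilinear_for *:%R *:%R (T : V -> W -> K^o).
  by split=> [y a x x'|x a y y']; [exact: Tl|exact: Tr].
pose T' : {bilinear V -> W -> K^o} :=
  HB.pack (T : V -> W -> K^o) (bilinear_isBilinear.Build _ _ _ _ _ _ _ Tb).
exists T'; split=> // -[x y] A /= /nbhs_nm[e e0 eA].
pose d : R := Num.min 1 (e / ((1 + `|c|) * (2 + nm x + nm y))).
have xy0 : 0 < 2 + nm x + nm y by rewrite !ltr_pwDl // nm_ge0.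
have d0 : 0 < d by rewrite lt_min ltr01 !divr_gt0 // mulr_gt0 // ltr_pwDl.
exists (ball x (toK d), ball y (toK d)) => /=.
  by split; apply/nbhs_nm; exists d => // z xz;
    rewrite -ball_normE /ball_ /= (nmE S) toK_lt.
move=> [x' y'] /=; rewrite -!ball_normE /ball_ /= !(nmE S) !toK_lt => -[dx dy].
apply: eA; rewrite nm_ab.
have -> : T x y - T x' y' = T (x - x') y + T x' (y - y').
  have -> : T (x - x') y = T x y - T x' y.
    by have := Tl (-1) x' x y; rewrite scaleN1r addrC => ->; ring.
  have -> : T x' (y - y') = T x' y - T x' y'.
    by have := Tr (-1) x' y' y; rewrite scaleN1r addrC => ->; ring.
  ring.
have nx' : nm x' <= 1 + nm x.
  have -> : x' = x - (x - x') by rewrite subKr.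
  apply: le_trans (nmB _ _ _) _; rewrite addrC lerD2r ltW //.
  by apply: lt_le_trans dx _; rewrite ge_min lexx.
have de : d * ((1 + `|c|) * (2 + nm x + nm y)) <= e.
  rewrite -ler_pdivlMr; first by rewrite ge_min lexx orbT.
  by rewrite mulr_gt0 // ltr_pwDl.
apply: le_lt_trans (abD _ _ _) _; apply: le_lt_trans (lerD (Tc _ _) (Tc _ _)) _.
have cc : c <= `|c| by exact: ler_norm.
have c0 : 0 <= `|c| by exact: normr_ge0.
have [nx ny] := (nm_ge0 S x', nm_ge0 S y).
have [nxx nyy] := (nm_ge0 S (x - x'), nm_ge0 S (y - y')).
have n0 := nm_ge0 S x.
apply: (@le_lt_trans _ _ (`|c| * d * nm y + `|c| * (1 + nm x) * d)).
  apply: lerD.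
    apply: ler_wpM2r => //; apply: (@le_trans _ _ (`|c| * nm (x - x'))).
      exact: ler_wpM2r.
    by apply: ler_wpM2l => //; exact: ltW.
  apply: (@le_trans _ _ (`|c| * nm x' * nm (y - y'))).
    by apply: ler_wpM2r => //; exact: ler_wpM2r.
  apply: ler_pM => //; [exact: mulr_ge0|exact: ler_wpM2l|exact: ltW].
apply: lt_le_trans de; have -> : `|c| * d * nm y + `|c| * (1 + nm x) * d =
  d * (`|c| * (1 + nm x + nm y)) by ring.
rewrite ltr_pM2l //.
have : 0 <= `|c| * nm x by exact: mulr_ge0.
have : 0 <= `|c| * nm y by exact: mulr_ge0.
by lra.
Qed.

(** Continuity at the origin bounds T on a product of two balls; rescaling first
x, with y fixed in its ball, and then y gives the bound everywhere. *)
Lemma continuous_bform (T : {bilinear V -> W -> K^o}) :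
  continuous_bilinear T -> exists2 c, 0 <= c & bform c T.
Proof.
move=> cT.
have Zl a x y : T (a *: x) y = a * T x y by rewrite linearZl_LR.
have Zr a x y : T x (a *: y) = a * T x y by rewrite linearZr_LR.
have : nbhs ((0, 0) : V * W) 
      ((fun p : V * W => T p.1 p.2) @^-1` [set z : K^o | nm z < 1]).
  apply: (cT (0, 0)); apply/nbhs_nm; exists 1 => // z /=.
  by rewrite linear0l sub0r nmN.
move=> [[A B] /= [/nbhs_nm[d1 d10 A1] /nbhs_nm[d2 d20 B2]] AB].
pose c1 := 2 / d2 * (2 / d1).
have c10 : 0 <= c1 by rewrite !mulr_ge0 // invr_ge0 ltW.
exists c1 => //; split=> [a x x' y|a x y y'|x y].
- by rewrite linearDl Zl.
- by rewrite linearDr Zr.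
- have h1 y0 : nm y0 < d2 -> forall x0, ab (T x0 y0) <= 2 / d1 * nm x0.
    move=> yd; apply: bounded_of_local => // [r x0 r0|x0 xd].
      by rewrite Zl abM ab_toK ger0_norm.
    have := AB (x0, y0); rewrite /= nm_ab => /(_ _)/ltW; apply.
    by split; [apply: A1|apply: B2]; rewrite sub0r nmN.
  have [x0|nx0] := eqVneq (nm x) 0.
    have -> : x = 0 by apply: nm_eq0 x0.
    by rewrite linear0l ab0 nm0 mulr0 mul0r.
  have px : 0 < 2 / d1 * nm x.
    by rewrite mulr_gt0 ?divr_gt0 // lt_neqAle eq_sym nx0 nm_ge0.
  have := @bounded_of_local W (fun y => ab (T x y) / (2 / d1 * nm x)) d2 d20.
  move=> /(_ _ _ y); rewrite ler_pdivrMr // /c1 => h.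
  apply: le_trans (h _ _) _.
  + by move=> r z r0; rewrite Zr abM ab_toK ger0_norm // mulrA.
  + by move=> z zd; rewrite ler_pdivrMr // mul1r; exact: h1.
  + by rewrite le_eqVlt; apply/orP; left; apply/eqP; ring.
Qed.

Lemma bform_sum c (T : V -> W -> K) : bform c T ->
  (forall I (r : seq I) (P : pred I) (F : I -> V) y,
     T (\sum_(i <- r | P i) F i) y = \sum_(i <- r | P i) T (F i) y) /\
  (forall I (r : seq I) (P : pred I) (F : I -> W) x,
     T x (\sum_(i <- r | P i) F i) = \sum_(i <- r | P i) T x (F i)).
Proof.
move=> [Tl Tr _]; split=> I r P F z.
  have [T0 TD _] := linear_formE (g := T^~ z) (fun a x x' => Tl a x x' z).
  exact: (big_morph (T^~ z) TD T0).
have [T0 TD _] := linear_formE (Tr^~ z).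
exact: (big_morph (T z) TD T0).
Qed.

Lemma bform_scale c (T : V -> W -> K) : bform c T ->
  (forall a x y, T (a *: x) y = a * T x y) /\
  (forall a x y, T x (a *: y) = a * T x y).
Proof.
move=> [Tl Tr _]; split=> a x y.
  have [_ _ TZ] := linear_formE (g := T^~ y) (fun a x x' => Tl a x x' y).
  exact: TZ.
by have [_ _ TZ] := linear_formE (Tr^~ x).
Qed.

Lemma bform_le c c' (T : V -> W -> K) : c <= c' -> bform c T -> bform c' T.
Proof.
move=> cc [Tl Tr Tc]; split=> // x y; apply: le_trans (Tc x y) _.
by rewrite -!mulrA ler_wpM2r // mulr_ge0 // nm_ge0.
Qed.

Lemma bform_comb a c c' (T T' : V -> W -> K) : bform c T -> bform c' T' ->
  bform (ab a * c + c') (fun x y => a * T x y + T' x y).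
Proof.
move=> [Tl Tr Tc] [Tl' Tr' Tc']; split=> [b x x' y|b x y y'|x y].
- by rewrite Tl Tl'; ring.
- by rewrite Tr Tr'; ring.
- apply: le_trans (abD _ _ _) _; rewrite abM -!mulrA [leRHS]mulrDl.
  rewrite lerD // ?mulrA // -mulrA -[leRHS]mulrA ler_wpM2l ?ab_ge0 //.
  by rewrite mulrA.
Qed.

End Forms.
End BoundedForms.

Section UniformBoundedness.
Variables (R : realType) (K : numFieldType) (S : scalars R K).
Variables V W : normedModType K.
Local Notation toK := (toK S).
Local Notation ab := (ab S).
Local Notation nm := (nm S).

(** The value of T on the tensor which is the sum of the x (x) y for (x, y) in
t. *)
Definition pairing (T : V -> W -> K) (t : seq (V * W)) : K :=
  \sum_(p <- t) T p.1 p.2.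

Lemma pairing_comb a (T T' : V -> W -> K) t :
  pairing (fun x y => a * T x y + T' x y) t = a * pairing T t + pairing T' t.
Proof. by rewrite /pairing big_split /= mulr_sumr. Qed.

Lemma bform0 : bform S 0 (fun (x : V) (y : W) => 0).
Proof. by split=> *; rewrite ?mulr0 ?addr0 // ab0 !mul0r. Qed.

Lemma bform_scale_to1 (T : V -> W -> K) (e : R) : 0 < e -> bform S e T ->
  bform S 1 (fun x y => toK e^-1 * T x y).
Proof.
move=> e0 Te; have [h1 h2 h3] := bform_comb (toK e^-1) Te bform0; split=> [a x
    x' y|a x y y'|x y].
- by have := h1 a x x' y; rewrite !addr0.
- by have := h2 a x y y'; rewrite !addr0.
- have := h3 x y; rewrite addr0 => /le_trans; apply.
  by rewrite addr0 ab_toK gtr0_norm ?invr_gt0 // mulVf ?gt_eqF.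
Qed.

(** The factor 4/3 is what the gliding hump needs: after the step 3^(-j), the
later steps sum to 3^(-j)/2, and 4/3 * 1/2 < 1. *)
Lemma near_maximal_form (t : seq (V * W)) T0 : bform S 1 T0 ->
  0 < ab (pairing T0 t) ->
  exists T, [/\ bform S 1 T, 3 / 4 * ab (pairing T0 t) <= ab (pairing T t) &
    forall T', bform S 1 T' -> ab (pairing T' t) <= 4 / 3 * ab (pairing T t)].
Proof.
move=> T01 p0; pose E := [set ab (pairing T t) | T in [set T | bform S 1 T]].
have bE : has_sup E.
  split; first by exists (ab (pairing T0 t)), T0.
  exists (\sum_(p <- t) nm p.1 * nm p.2) => _ [T [_ _ Tc] <-].
  apply: le_trans (ab_sum _ _ _ _) _.
  by apply: ler_sum => p _; rewrite -[nm p.1]mul1r.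
have M0 T : bform S 1 T -> ab (pairing T t) <= sup E.
  by move=> T1; apply: ub_le_sup; [case: bE|exists T].
have Mp := lt_le_trans p0 (M0 _ T01).
have Mp4 : 0 < sup E / 4 by rewrite divr_gt0.
have [_ [T T1 <-] hT] := sup_adherent Mp4 bE.
have hT' : 3 / 4 * sup E <= ab (pairing T t) by lra.
exists T; split=> // [|T' /M0 hT'']; last by lra.
by apply: le_trans hT'; rewrite ler_pM2l ?divr_gt0 // M0.
Qed.

(** Gliding hump. If no C exists, there are tensors t_j in Phi and forms U_j of
norm at most 1, nearly maximal on t_j, with values on t_j of order j 3^j. Put
T = sum_j s_j 3^(-j) U_j, each sign s_j being chosen such that the partial sum
through j has on t_j at least the absolute value that 3^(-j) U_j alone has. The
remaining terms change this by at most two thirds, because U_j is nearly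
maximal; so T, which is bounded, is unbounded on Phi. *)
Lemma uniform_boundedness (Phi : set (seq (V * W))) :
  (forall c T, bform S c T ->
     exists B, forall t, Phi t -> ab (pairing T t) <= B) ->
  exists C, forall T t, bform S 1 T -> Phi t -> ab (pairing T t) <= C.
Proof.
move=> hPhi; apply: contrapT => nC.
have gap (C : R) : exists p : (V -> W -> K) * seq (V * W),
    [/\ bform S 1 p.1, Phi p.2, C < ab (pairing p.1 p.2) &
    forall T', bform S 1 T' ->
      ab (pairing T' p.2) <= 4 / 3 * ab (pairing p.1 p.2)].
  apply: contrapT => ngap; apply: nC.
  exists (Num.max 0 (4 / 3 * C)) => T t T1 tP.
  rewrite leNgt; apply/negP; rewrite gt_max => /andP[p0 pC].
  have [T' [T'1 T'C T'm]] := near_maximal_form T1 p0.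
  by apply: ngap; exists (T', t); split=> //=; lra.
have [p hp] := choice gap.
pose g j : R := (3 ^+ j)^-1.
have g0 j : 0 < g j by rewrite invr_gt0 exprn_gt0.
have gS j : g j.+1 = g j / 3 by rewrite /g exprS invfM mulrC.
pose C j : R := 3 * j%:R * 3 ^+ j.
pose t j := (p (C j)).2; pose U j := (p (C j)).1.
have U1 j : bform S 1 (U j) by have [] := hp (C j).
pose sgn (P : V -> W -> K) j : K :=
  if g j * ab (pairing (U j) (t j)) <=
     ab (pairing (fun x y => toK (g j) * U j x y + P x y) (t j))
  then toK (g j) else - toK (g j).
pose fix P j := if j is i.+1 then
  (fun x y => sgn (P i) i * U i x y + P i x y) else (fun x y => 0).
have absgn Q j : ab (sgn Q j) = g j.
  by rewrite /sgn; case: ifP; rewrite ?abN ab_toK gtr0_norm.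
(* The average of the absolute values obtained with the two signs is at least
   that of the added term alone. *)
have Plarge j : g j * ab (pairing (U j) (t j)) <= ab (pairing (P j.+1) (t j)).
  rewrite /= /sgn; case: ifPn => // /negbTE.
  set Q := P j => /negbT; rewrite -ltNge !pairing_comb => h.
  have := abD S (toK (g j) * pairing (U j) (t j) + pairing Q (t j))
    (- (- toK (g j) * pairing (U j) (t j) + pairing Q (t j))).
  rewrite abN; set z := _ + - _ => h2.
  have zE : z = toK (2 * g j) * pairing (U j) (t j).
    by rewrite /z rmorphM /= rmorph_nat; ring.
  move: h2; rewrite zE abM ab_toK gtr0_norm ?mulr_gt0 //.
  have := ab_ge0 S (pairing (U j) (t j)); have := g0 j; nra.
have Pdiff j i : (j <= i)%N ->
    bform S (3 / 2 * (g j - g i)) (fun x y => P i x y - P j x y).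
  move=> /subnK <-; elim: (i - j)%N => [|k IH].
    rewrite subrr mulr0.
    have -> : (fun x y => P (0 + j)%N x y - P j x y) = fun x y => 0.
      by apply/funext => x; apply/funext => y; rewrite subrr.
    exact: bform0.
  have := bform_comb (sgn (P (k + j)%N) (k + j)%N) (U1 (k + j)%N) IH.
  rewrite absgn addSn gS /=; set f := (X in bform _ _ X -> _).
  set f' := (X in _ -> bform _ _ X).
  have -> : f = f' by apply/funext => x; apply/funext => y; rewrite /f /f' addrA.
  by apply: bform_le; rewrite mulr1; lra.
have Pb x y j i : (j <= i)%N ->
    ab (P i x y - P j x y) <= 3 / 2 * g j * nm x * nm y.
  move=> /Pdiff [_ _ /(_ x y)] /le_trans; apply.
  rewrite ler_wpM2r ?nm_ge0 // ler_wpM2r ?nm_ge0 // ler_wpM2l //.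
  by rewrite lerBlDr lerDl ltW.
have [LIM [LIMl LIMc]] := generalized_limit S.
have bP x y : bounded_seq S (fun j => P j x y).
  by exists (3 / 2 * g 0%N * nm x * nm y) => j; have := Pb x y 0%N j; rewrite
      subr0; exact.
pose T x y := LIM (fun j => P j x y).
have Pf i : exists c, bform S c (P i).
  have := Pdiff 0%N i (leq0n i); set f := (X in bform _ _ X).
  have -> : f = P i by apply/funext => x; apply/funext => y; rewrite /f subr0.
  by move=> h; eexists; exact: h.
have Tc j x y : ab (T x y - P j x y) <= 3 / 2 * g j * nm x * nm y.
  exact: LIMc (Pb x y j).
have Tb : bform S (3 / 2) T.
  split=> [a x x' y|a x y y'|x y]; last first.
  - by have := Tc 0%N x y; rewrite /= subr0 /g expr0 invr1 mulr1.
  - rewrite /T -LIMl //; congr LIM; apply/funext => i.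
    by have [c [_ h _]] := Pf i.
  - rewrite /T -LIMl //; congr LIM; apply/funext => i.
    by have [c [h _ _]] := Pf i.
have TPb j : bform S (3 / 2 * g j) (fun x y => T x y - P j x y).
  have [c Pc] := Pf j.
  have [h1 h2 _] := bform_comb (-1) Pc Tb.
  split=> [a x x' y|a x y y'|x y]; last exact: Tc.
  - by have := h1 a x x' y; rewrite !mulN1r ![- _ + T _ _]addrC.
  - by have := h2 a x y y'; rewrite !mulN1r ![- _ + T _ _]addrC.
have [B hB] := hPhi _ _ Tb.
pose j := (Num.truncn B).+1.
have [_ tP Cp maxp] := hp (C j); rewrite -/(t j) -/(U j) in tP Cp maxp.
have := hB _ tP; apply/negP; rewrite -ltNge.
have e0 : 0 < 3 / 2 * g j.+1 by rewrite mulr_gt0.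
have /maxp := bform_scale_to1 e0 (TPb j.+1).
have -> : pairing (fun x y => toK (3 / 2 * g j.+1)^-1 * (T x y - P j.+1 x y)) (t j)
    = toK (3 / 2 * g j.+1)^-1 * pairing (fun x y => T x y - P j.+1 x y) (t j).
  by rewrite /pairing mulr_sumr.
rewrite abM ab_toK gtr0_norm ?invr_gt0 // ler_pdivrMl //.
have -> : pairing (fun x y => T x y - P j.+1 x y) (t j) =
    pairing T (t j) - pairing (P j.+1) (t j).
  by rewrite /pairing raddf_sum -big_split.
move=> h1; have h2 := Plarge j.
have h3' : ab (pairing (P j.+1) (t j)) <= ab (pairing T (t j)) +
    ab (pairing T (t j) - pairing (P j.+1) (t j)).
  by rewrite -[ab (_ - _)]abN opprB (le_trans _ (abD _ _ _)) // addrC subrK.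
have jB : B < j%:R by exact: truncnS_gt.
have gC : g j * C j = 3 * j%:R.
  by rewrite /g /C mulrC mulfK // expf_neq0.
have : g j * C j < g j * ab (pairing (U j) (t j)) by rewrite ltr_pM2l.
rewrite gC; rewrite gS in h1.
set u := ab (pairing (U j) (t j)) in h1 h2 *.
have h1' : ab (pairing T (t j) - pairing (P j.+1) (t j)) <= 2 / 3 * (g j * u).
  by apply: le_trans h1 _; rewrite le_eqVlt; apply/orP; left; apply/eqP; field.
by set v := g j * u in h2 h1' *; lra.
Qed.

End UniformBoundedness.

(** * The Hahn-Banach theorem *)

Section HahnBanach.
Variables (R : realType) (K : numFieldType) (S : scalars R K).
Local Notation toK := (toK S).
Local Notation re := (re S).
Local Notation ab := (ab S).
Local Notation nm := (nm S).

Section Real.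
Variables (E : normedModType K) (M : R).

Let lin (G : set (E * R)) := forall r z a w b,
  G (z, a) -> G (w, b) -> G (toK r *: z + w, r * a + b).
Let dominated (G : set (E * R)) := forall z a, G (z, a) -> a <= M * nm z.

(** Extension to one more direction v: domination asks c to lie above all
a - M |z - v| and below all M |w + v| - b for (z, a) and (w, b) in the graph G,
and the triangle inequality makes the former at most the latter. *)
Lemma real_hahn_banach_step (G : set (E * R)) (v : E) : 0 <= M ->
  G (0, 0) -> lin G -> dominated G ->
  exists c, let G' := [set q | exists r z a,
    G (z, a) /\ q = (z + toK r *: v, a + r * c)] in lin G' /\ dominated G'.
Proof.
move=> M0 G0 linG domG.
pose A := [set q.2 - M * nm (q.1 - v) | q in G].
have key z a w b : G (z, a) -> G (w, b) ->
    a - M * nm (z - v) <= M * nm (w + v) - b.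
  move=> Gz Gw; have := domG _ _ (linG 1 _ _ _ _ Gz Gw).
  rewrite rmorph1 scale1r mul1r => h.
  have : nm (z + w) <= nm (z - v) + nm (w + v).
    have -> : z + w = (z - v) + (w + v) by rewrite addrACA addNr addr0.
    exact: nmD.
  move=> /(ler_wpM2l M0) h2.
  by rewrite lerBlDr addrAC lerBrDr (le_trans h) // (le_trans h2) // mulrDr addrC.
have supA : has_sup A.
  split; first by exists (0 - M * nm (0 - v)), (0, 0).
  exists (M * nm (0 + v) - 0) => _ [[z a] Gz <-]; exact: key.
have cge z a : G (z, a) -> a - M * nm (z - v) <= sup A.
  by move=> Gz; apply: ub_le_sup; [case: supA|exists (z, a)].
have cle w b : G (w, b) -> sup A <= M * nm (w + v) - b.
  by move=> Gw; apply: ge_sup; [case: supA|move=> _ [[z a] Gz <-]; exact: key].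
have scaleG r z a : G (z, a) -> G (toK r *: z, r * a).
  by move=> /(linG r _ _ _ _)/(_ G0); rewrite !addr0.
exists (sup A); split.
  move=> r _ _ _ _ [r1 [z1 [a1 [G1 [-> ->]]]]] [r2 [z2 [a2 [G2 [-> ->]]]]].
  exists (r * r1 + r2), (toK r *: z1 + z2), (r * a1 + a2).
  split; first exact: linG.
  congr pair; last by ring.
  by rewrite rmorphD rmorphM /= scalerDl scalerDr scalerA addrACA.
move=> _ _ [r [z [a [Gz [-> ->]]]]].
have [r0|r0|->] := ltrgtP r 0; last by rewrite rmorph0 scale0r mul0r !addr0 domG.
  have s0 : 0 < - r by rewrite oppr_gt0.
  have := cge _ _ (scaleG (- r)^-1 _ _ Gz).
  have -> : nm (z + toK r *: v) = - r * nm (toK (- r)^-1 *: z - v).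
    rewrite -[X in X * _](gtr0_norm s0) -(ab_toK S) -nmZ scalerBr scalerA.
    rewrite -rmorphM mulfV ?gt_eqF // rmorph1 scale1r.
    by rewrite [in RHS]rmorphN scaleNr opprK.
  rewrite -(ler_pM2l s0) mulrBr mulVKf ?gt_eqF //.
  by move=> h; rewrite mulrCA; lra.
have := cle _ _ (scaleG r^-1 _ _ Gz).
have -> : nm (z + toK r *: v) = r * nm (toK r^-1 *: z + v).
  rewrite -[X in X * _](gtr0_norm r0) -(ab_toK S) -nmZ scalerDr scalerA.
  by rewrite -rmorphM mulfV ?gt_eqF // rmorph1 scale1r.
rewrite -(ler_pM2l r0) mulrBr mulVKf ?gt_eqF //.
by move=> h; rewrite mulrCA; lra.
Qed.

(** Zorn's lemma on graphs of dominated partial functionals that extend G0. The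
graphs are considered in the form A `|` G0 so that the empty chain needs no
separate treatment. *)
Lemma real_hahn_banach (G0 : set (E * R)) : 0 <= M ->
  G0 (0, 0) -> lin G0 -> dominated G0 ->
  exists u : E -> R, [/\ forall r z w, u (toK r *: z + w) = r * u z + u w,
    forall z, u z <= M * nm z & forall z a, G0 (z, a) -> u z = a].
Proof.
move=> M0 G00 lin0 dom0.
pose P A := lin (A `|` G0) /\ dominated (A `|` G0).
have [F FP totF|A [[linA domA] maxA]] := @Zorn_bigcup _ P.
  split.
    move=> r z a w b Gz Gw.
    have two : exists2 B, P B & (B `|` G0) (z, a) /\ (B `|` G0) (w, b) /\
        (B `<=` \bigcup_(X in F) X).
      case: Gz Gw => [[B1 FB1 B1z]|Gz] [[B2 FB2 B2w]|Gw].
      - have [B12|B21] := totF _ _ FB1 FB2.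
          exists B2; first exact: FP.
          split; first by left; exact: B12.
          by split; [left|move=> q Bq; exists B2].
        exists B1; first exact: FP.
        split; first by left.
        by split; [left; exact: B21|move=> q Bq; exists B1].
      - exists B1; first exact: FP.
        by split; [left|split; [right|move=> q Bq; exists B1]].
      - exists B2; first exact: FP.
        by split; [right|split; [left|move=> q Bq; exists B2]].
      - exists set0; first by split; rewrite set0U.
        by split; [right|split; [right|move=> q]].
    have [B [linB _] [Bz [Bw BF]]] := two.
    by have [/BF|] := linB r _ _ _ _ Bz Bw; [left|right].
  move=> z a [[B FB Bz]|/dom0//].
  by have [_ domB] := FP _ FB; apply: domB; left.
set G := A `|` G0 in linA domA.
have total z : exists a, G (z, a).
  apply: contrapT => nz.
  have GG0 : G (0, 0) by right.
  have [c] := real_hahn_banach_step z M0 GG0 linA domA.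
  set G' := [set q | _] => -[linG' domG'].
  have GG' : G `<=` G'.
    move=> [w a] Gw; exists 0, w, a; split=> //.
    by rewrite rmorph0 scale0r mul0r !addr0.
  have G'z : G' (z, c).
    by exists 1, 0, 0; rewrite rmorph1 scale1r mul1r !add0r.
  apply: (maxA G').
    split; first by move=> q Aq; apply: GG'; left.
    by move=> G'A; apply: nz; exists c; left; exact: G'A.
  have -> : P G' = (lin G' /\ dominated G') by rewrite /P setUidl // => q Gq;
      apply: GG'; right.
  by [].
have [u Gu] := choice total.
have fun_G z a b : G (z, a) -> G (z, b) -> a = b.
  have half c d : G (z, c) -> G (z, d) -> c <= d.
    move=> Gc Gd; have := domA _ _ (linA (-1) _ _ _ _ Gd Gc).
    rewrite rmorphN1 scaleN1r addNr nm0 mulr0 mulN1r addrC subr_le0; exact.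
  by move=> Ga Gb; apply/le_anti; rewrite !half.
exists u; split=> [r z w|z|z a Gz]; last by apply: fun_G (Gu z) _; right.
- by apply: fun_G (Gu _) _; apply: linA.
- exact: domA.
Qed.

End Real.

(** A scalar functional g is determined by its real part u through
g z = u z - iu * u (iu * z); for the bound, rotate z so that g z becomes a
nonnegative real number, which is then a value of u. *)
Theorem hahn_banach (X E : normedModType K) (i : X -> E) (f : X -> K) (M : R) :
  0 <= M -> (forall a x y, i (a *: x + y) = a *: i x + i y) ->
  (forall x, nm (i x) = nm x) ->
  (forall a x y, f (a *: x + y) = a * f x + f y) ->
  (forall x, ab (f x) <= M * nm x) ->
  exists g : E -> K, [/\ forall a z w, g (a *: z + w) = a * g z + g w,
    forall z, ab (g z) <= M * nm z & forall x, g (i x) = f x].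
Proof.
move=> M0 il inm fl fM.
have i0 : i 0 = 0 by have := il (-1) 0 0; rewrite scaler0 addr0 scaleN1r addNr.
have [f0 _ fZ] := linear_formE fl.
have iZ a x : i (a *: x) = a *: i x by have := il a x 0; rewrite i0 !addr0.
have [|||u [ul uM uf]] :=
    @real_hahn_banach E M [set q | exists x, q = (i x, re (f x))] M0.
- by exists 0; rewrite i0 f0 re0.
- move=> r _ _ _ _ [x [-> ->]] [y [-> ->]]; exists (toK r *: x + y).
  by rewrite il fl reD reZ.
- move=> _ _ [x [-> ->]]; apply: le_trans (ler_norm _) _.
  by apply: le_trans (re_le_ab _ _) _; rewrite inm.
have u0 : u 0 = 0 by have := ul (-1) 0 0; rewrite scaler0 addr0 mulN1r addNr.
have uD z w : u (z + w) = u z + u w.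
  by have := ul 1 z w; rewrite rmorph1 scale1r mul1r.
have uZ r z : u (toK r *: z) = r * u z by have := ul r z 0; rewrite u0 !addr0.
have uN z : u (- z) = - u z by rewrite -scaleN1r -(rmorphN1 toK) uZ mulN1r.
pose g z := toK (u z) - iu S * toK (u (iu S *: z)).
have gD z w : g (z + w) = g z + g w.
  by rewrite /g scalerDr !uD !rmorphD /=; ring.
have gR r z : g (toK r *: z) = toK r * g z.
  by rewrite /g scalerA [iu S * toK r]mulrC -scalerA !uZ !rmorphM /=; ring.
have gI z : g (iu S *: z) = iu S * g z.
  rewrite /g; have [->|i2] := iuE S.
    by rewrite !scale0r u0 !mul0r rmorph0 subr0.
  rewrite scalerA i2 scaleN1r uN rmorphN /= mulrBr mulrA i2. ring.
have gZ a z : g (a *: z) = a * g z.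
  by rewrite {1}(scalarE S a) scalerDl gD gR -scalerA gI gR mulrA -mulrDl -scalarE.
have reg z : re (g z) = u z.
  by rewrite /g reD -mulrN mulrC -rmorphN reZ re_iu mulr0 addr0 re_toK.
exists g; split=> [a z w|z|x]; first by rewrite gD gZ.
- have [->|/eqP gz] := eqVneq (g z) 0; first by rewrite ab0 mulr_ge0 ?nm_ge0.
  pose c := toK (ab (g z)) / g z.
  have c1 : ab c = 1.
    by rewrite abM abV ab_toK ger0_norm ?ab_ge0 // mulfV // gt_eqF // ab_gt0.
  have := uM (c *: z); rewrite nmZ c1 mul1r -reg gZ divfK ?re_toK //.
  exact/eqP.
- have -> : g (i x) = toK (re (f x)) - iu S * toK (re (iu S * f x)).
    by rewrite /g -iZ -fZ; congr (toK _ - _ * toK _); apply: uf; eexists.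
  rewrite {3}(scalarE S (f x)); have [->|i2] := iuE S; first by rewrite !mul0r
      subr0 addr0.
  have -> : re (iu S * f x) = - im S (f x).
    rewrite {1}(scalarE S (f x)) mulrDr mulrA i2 reD mulrC reZ re_iu mulr0 add0r.
    by rewrite mulN1r -rmorphN re_toK.
  by rewrite rmorphN mulrN opprK.
Qed.

(** Hahn-Banach for the line spanned by x, the isometric image of K. *)
Lemma norming_functional (E : normedModType K) (x : E) :
  exists g : E -> K, [/\ forall a z w, g (a *: z + w) = a * g z + g w,
    forall z, ab (g z) <= nm z & ab (g x) = nm x].
Proof.
have [->|/eqP x0] := eqVneq x 0.
  by exists (fun _ => 0); split=> *; rewrite ?mulr0 ?addr0 ?ab0 ?nm_ge0 ?nm0.
have nx := nm_gt0 S x0.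
pose v := toK (nm x)^-1 *: x.
have v1 : nm v = 1 by rewrite nmZ ab_toK gtr0_norm ?invr_gt0 // mulVf ?gt_eqF.
have [g [gl gM gv]] : exists g : E -> K,
    [/\ forall a z w, g (a *: z + w) = a * g z + g w,
        forall z, ab (g z) <= 1 * nm z & forall a : K^o, g (a *: v) = a].
  apply: hahn_banach => // [a b c|a|a].
  - by rewrite scalerDl; congr (_ + _); exact: (esym (scalerA a b v)).
  - by rewrite nmZ v1 mulr1 nm_ab.
  - by rewrite nm_ab mul1r.
have [g0 _ _] := linear_formE gl.
exists g; split=> // [z|]; first by rewrite -[leRHS]mul1r gM.
have := gv 1; rewrite scale1r => gv1.
have -> : x = toK (nm x) *: v + 0.
  by rewrite addr0 scalerA -rmorphM mulfV ?gt_eqF // rmorph1 scale1r.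
by rewrite gl gv1 g0 !addr0 abM nmZ ab1 v1.
Qed.

End HahnBanach.

(** * Grothendieck's inequality *)

Lemma geo_small (R : realType) (A e : R) : 0 < e ->
  exists n, A / 2 ^+ n < e.
Proof.
move=> e0; have [A0|A0] := leP A 0.
  by exists 0%N; rewrite expr0 divr1 (le_lt_trans A0).
exists (Num.truncn (A / e)).+1.
rewrite ltr_pdivrMr ?exprn_gt0 // -ltr_pdivrMl // mulrC.
apply: (lt_trans (truncnS_gt _)).
by rewrite -natrX ltr_nat ltn_expl.
Qed.

(** Rademacher functions r_k on the finite probability space W, together with
the case p = 4 of Khinchine's inequality; sums over W stand for expectations
multiplied by #|W|. *)
Lemma rademacher (R : realType) (n : nat) :
  exists (W : finType) (r : nat -> W -> R), [/\ (0 < #|W|)%N,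
    forall x y : 'I_n -> R,
      \sum_w (\sum_k x k * r k w) * (\sum_k y k * r k w) =
      #|W|%:R * \sum_k x k * y k &
    forall x : 'I_n -> R,
      \sum_w (\sum_k x k * r k w) ^+ 4 <=
      #|W|%:R * (3 * (\sum_k x k ^+ 2) ^+ 2)].
Proof.
elim: n => [|n [W [r [W0 rxy r4]]]].
  exists unit, (fun _ _ => 0); split => [|x y|x]; first by rewrite card_unit.
    by rewrite big1 ?big_ord0 ?mulr0 // => w _; rewrite big_ord0 mul0r.
  by rewrite big1 ?big_ord0 ?expr0n ?mulr0 // => w _; rewrite big_ord0 expr0n.
(* The new function is the sign given by the second component of W * bool. *)
pose r' k (p : W * bool) : R :=
  if k == n then (if p.2 then 1 else -1) else r k p.1.
have r'E (x : 'I_n.+1 -> R) w b : \sum_k x k * r' k (w, b) =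
    \sum_(k < n) x (widen_ord (leqnSn n) k) * r k w +
    x ord_max * (if b then 1 else -1).
  rewrite big_ord_recr /= /r' /= eqxx; congr (_ + _).
  by apply: eq_bigr => k _; rewrite ltn_eqF.
have sumE (F : W * bool -> R) :
    \sum_p F p = \sum_w (F (w, true) + F (w, false)).
  transitivity (\sum_w \sum_b F (w, b)).
    by rewrite pair_bigA; apply: eq_bigr => -[].
  by apply: eq_bigr => w _; rewrite big_bool.
exists (W * bool)%type, r'; split => [|x y|x].
- by rewrite card_prod card_bool muln_gt0 W0.
- rewrite sumE card_prod card_bool natrM !big_ord_recr /=.
  rewrite (eq_bigr (fun w =>
    ((\sum_(k < n) x (widen_ord (leqnSn n) k) * r k w) *
     (\sum_(k < n) y (widen_ord (leqnSn n) k) * r k w)) * 2 +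
    2 * (x ord_max * y ord_max))) => [|w _]; last by rewrite !r'E; ring.
  rewrite big_split /= -mulr_suml rxy sumr_const -mulr_natl; ring.
- rewrite sumE card_prod card_bool natrM !big_ord_recr /=.
  set a := x ord_max; pose xn k := x (widen_ord (leqnSn n) k).
  set A := \sum_(k < n) _.
  rewrite (eq_bigr (fun w => (\sum_(k < n) xn k * r k w) ^+ 4 * 2 +
    ((\sum_(k < n) xn k * r k w) * (\sum_(k < n) xn k * r k w)) * (12 * a ^+ 2)
    + 2 * a ^+ 4)) => [|w _]; last by rewrite !r'E -/a -/(xn _); ring.
  rewrite !big_split /= -!mulr_suml rxy sumr_const. rewrite -(mulr_natr 2 #|_|).
  have -> : \sum_(k < n) xn k * xn k = A by apply: eq_bigr => k _.
  have A0 : 0 <= A by apply: sumr_ge0 => k _; exact: sqr_ge0.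
  have := r4 xn; rewrite -/A => h4.
  have w0 : 0 < #|W|%:R :> R by rewrite ltr0n.
  move: h4; set P := \sum_w _ => h4.
  have : 0 <= #|W|%:R * (4 * a ^+ 4).
    by apply: mulr_ge0; [exact: ltW|rewrite -[4%N]/(2 * 2)%N exprM mulr_ge0 // sqr_ge0].
  by nra.
Qed.

Section Grothendieck.
Variables (R : realType) (L L' : finType) (s : L -> L' -> R) (B : R).
Hypothesis sB : forall (u : L -> R) (v : L' -> R),
  (forall l, `|u l| <= 1) -> (forall l, `|v l| <= 1) ->
  `|\sum_l \sum_l' s l l' * (u l * v l')| <= B.

(** The index set D varies because the improvement step replaces vectors indexed
by D by functions on a larger finite probability space. *)
Let hilbert_bound (c : R) := forall (D : finType)
  (x : L -> D -> R) (y : L' -> D -> R),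
  (forall l, \sum_d x l d ^+ 2 <= 1) -> (forall l, \sum_d y l d ^+ 2 <= 1) ->
  `|\sum_l \sum_l' s l l' * \sum_d x l d * y l' d| <= c.

(** A bound depending on s, but finite: what allows the improvement step to be
iterated. *)
Lemma hilbert_bound_sum : hilbert_bound (\sum_l \sum_l' `|s l l'|).
Proof.
move=> D x y x1 y1; apply: le_trans (ler_norm_sum _ _ _) _.
apply: ler_sum => l _; apply: le_trans (ler_norm_sum _ _ _) _.
apply: ler_sum => l' _; rewrite normrM ler_piMr //.
apply: le_trans (ler_norm_sum _ _ _) _.
apply: (@le_trans _ _ (\sum_d (x l d ^+ 2 / 2 + y l' d ^+ 2 / 2))).
  apply: ler_sum => d _; rewrite normrM -(real_normK (num_real (x l d))).
  rewrite -(real_normK (num_real (y l' d))).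
  by have := sqr_ge0 (`|x l d| - `|y l' d|); lra.
rewrite big_split /= -!mulr_suml.
by have := x1 l; have := y1 l'; lra.
Qed.

Let trunc (t : R) := if `|t| <= 8 then t else 0.

Lemma sqr_truncr_le t : (trunc t) ^+ 2 <= t ^+ 2.
Proof. by rewrite /trunc; case: ifP => // _; rewrite expr0n sqr_ge0. Qed.

Lemma sqr_truncr_tail t : (t - trunc t) ^+ 2 <= t ^+ 4 / 64.
Proof.
rewrite /trunc; case: ifPn => [_|].
  by rewrite subrr expr0n divr_ge0 // -[4%N]/(2 * 2)%N exprM sqr_ge0.
rewrite -ltNge subr0 -[4%N]/(2 * 2)%N exprM => t8.
have : 64 <= t ^+ 2.
  by rewrite -(real_normK (num_real t)); nra.
rewrite ler_pdivlMr // (expr2 (t ^+ 2)) => t64.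
by rewrite ler_wpM2l // sqr_ge0.
Qed.

(** Realize the vectors x_l, y_l as random variables X_l, Y_l, Rademacher sums,
so that <x_l, y_l> = E(X_l Y_l), and truncate them at height 8. The product of
the truncated parts is, pointwise, covered by the hypothesis on s; the tails
have L^2 norm at most 1/4 by the bound on fourth moments, so the two remaining
terms are covered by the given bound c, with a factor 1/4 each. *)
Lemma hilbert_bound_step c : hilbert_bound c -> hilbert_bound (64 * B + c / 2).
Proof.
move=> Hc D x y x1 y1.
have [W [r [W0 rxy r4]]] := rademacher R #|D|.
have w0 : 0 < #|W|%:R :> R by rewrite ltr0n.
pose X l w := \sum_(k < #|D|) x l (enum_val k) * r k w.
pose Y l w := \sum_(k < #|D|) y l (enum_val k) * r k w.
(* q turns unnormalized sums over W into expectations of squares. *)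
pose q : R := (Num.sqrt #|W|%:R)^-1.
have q2 : q ^+ 2 = #|W|%:R^-1 by rewrite exprVn sqr_sqrtr // ltW.
have sumD (F : D -> R) : \sum_d F d = \sum_(k < #|D|) F (enum_val k).
  by rewrite big_enum_val.
have small (J : finType) (z : J -> D -> R) l :
    (forall l, \sum_d z l d ^+ 2 <= 1) ->
    let Z w := \sum_(k < #|D|) z l (enum_val k) * r k w in
    [/\ \sum_w (q * Z w) ^+ 2 <= 1, \sum_w (q * trunc (Z w)) ^+ 2 <= 1 &
        \sum_w (4 * q * (Z w - trunc (Z w))) ^+ 2 <= 1].
  move=> z1 Z; have := z1 l; rewrite sumD => zl.
  have Z2 : \sum_w (Z w) ^+ 2 <= #|W|%:R.
    under eq_bigr do rewrite expr2.
    by rewrite rxy -[leRHS]mulr1 ler_pM2l //; under eq_bigr do rewrite -expr2.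
  have Z4 : \sum_w (Z w) ^+ 4 <= #|W|%:R * 3.
    apply: le_trans (r4 _) _; rewrite ler_pM2l // ler_piMr //.
    by rewrite exprn_ile1 // sumr_ge0 // => k _; exact: sqr_ge0.
  split.
  - under eq_bigr do rewrite exprMn.
    by rewrite -mulr_sumr q2 ler_pdivrMl // mulr1.
  - under eq_bigr do rewrite exprMn.
    rewrite -mulr_sumr q2 ler_pdivrMl // mulr1; apply: le_trans Z2.
    by apply: ler_sum => w _; exact: sqr_truncr_le.
  - under eq_bigr do rewrite exprMn.
    rewrite -mulr_sumr exprMn q2 mulrAC ler_pdivrMr // mul1r.
    apply: (@le_trans _ _ (4 ^+ 2 * ((#|W|%:R * 3) / 64))); last by lra.
    rewrite ler_pM2l ?exprn_gt0 //.
    apply: le_trans (ler_wpM2r _ Z4); last by rewrite invr_ge0.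
    rewrite mulr_suml.
    by apply: ler_sum => w _; exact: sqr_truncr_tail.
have XY l l' : \sum_d x l d * y l' d =
    #|W|%:R^-1 * (\sum_w trunc (X l w) * trunc (Y l' w)) +
    4^-1 * (\sum_w (4 * q * (X l w - trunc (X l w))) * (q * Y l' w)) +
    4^-1 * (\sum_w (q * trunc (X l w)) * (4 * q * (Y l' w - trunc (Y l' w)))).
  have -> : \sum_d x l d * y l' d = #|W|%:R^-1 * \sum_w X l w * Y l' w.
    by rewrite rxy mulKf ?gt_eqF // sumD.
  rewrite !mulr_sumr -!big_split /=; apply: eq_bigr => w _.
  by rewrite -q2; field.
under eq_bigr => l _ do (under eq_bigr => l' _ do rewrite XY !mulrDr;
  rewrite !big_split /=).
rewrite !big_split /=.
have -> : 64 * B + c / 2 = 64 * B + 4^-1 * c + 4^-1 * c by lra.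
apply: le_trans (ler_normD _ _) _; apply: lerD.
  apply: le_trans (ler_normD _ _) _; apply: lerD.
    have -> : \sum_l \sum_l' s l l' *
          (#|W|%:R^-1 * \sum_w trunc (X l w) * trunc (Y l' w)) =
        #|W|%:R^-1 * \sum_w 64 * \sum_l \sum_l' s l l' *
          ((trunc (X l w) / 8) * (trunc (Y l' w) / 8)).
      rewrite (eq_bigr (fun w => \sum_l \sum_l' s l l' *
          (trunc (X l w) * trunc (Y l' w)))); last first.
        move=> w _; rewrite mulr_sumr; apply: eq_bigr => l _.
        by rewrite mulr_sumr; apply: eq_bigr => l' _; field.
      rewrite [in RHS]exchange_big mulr_sumr; apply: eq_bigr => l _ /=.
      rewrite [in RHS]exchange_big mulr_sumr; apply: eq_bigr => l' _ /=.
      by rewrite -mulr_sumr mulrCA.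
    rewrite normrM gtr0_norm ?invr_gt0 // ler_pdivrMl //.
    apply: le_trans (ler_norm_sum _ _ _) _.
    have -> : #|W|%:R * (64 * B) = \sum_(w : W) (64 * B).
      by rewrite sumr_const -[RHS]mulr_natl.
    apply: ler_sum => w _.
    rewrite normrM ger0_norm // ler_pM2l //.
    have t1 t : `|trunc t / 8| <= 1.
      rewrite normrM normfV (@ger0_norm _ 8) // ler_pdivrMr // mul1r /trunc.
      by case: ifP => //; rewrite normr0.
    exact: sB.
  have := Hc W (fun l w => 4 * q * (X l w - trunc (X l w)))
    (fun l w => q * Y l w).
  set Q := \sum_l _ => HQ.
  rewrite (_ : \sum_l _ = 4^-1 * Q); last first.
    rewrite mulr_sumr; apply: eq_bigr => l _.
    by rewrite mulr_sumr; apply: eq_bigr => l' _; rewrite mulrCA.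
  rewrite normrM ger0_norm ?invr_ge0 // ler_pM2l ?invr_gt0 //.
  by apply: HQ => l; [case: (small _ x l x1)|case: (small _ y l y1)].
have := Hc W (fun l w => q * trunc (X l w))
  (fun l w => 4 * q * (Y l w - trunc (Y l w))).
set Q := \sum_l _ => HQ.
rewrite (_ : \sum_l _ = 4^-1 * Q); last first.
  rewrite mulr_sumr; apply: eq_bigr => l _.
  by rewrite mulr_sumr; apply: eq_bigr => l' _; rewrite mulrCA.
rewrite normrM ger0_norm ?invr_ge0 // ler_pM2l ?invr_gt0 //.
by apply: HQ => l; [case: (small _ x l x1)|case: (small _ y l y1)].
Qed.

(** The fixed point of c |-> 64 B + c / 2. *)
Theorem grothendieck_finite : hilbert_bound (128 * B).
Proof.
pose A := \sum_l \sum_l' `|s l l'|.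
have it n : hilbert_bound (128 * B + (A - 128 * B) / 2 ^+ n).
  elim: n => [|n /hilbert_bound_step].
    by rewrite expr0 divr1 addrCA subrr addr0; exact: hilbert_bound_sum.
  set c := (X in hilbert_bound X -> _); set c' := (X in _ -> hilbert_bound X).
  suff -> : c = c' by [].
  by rewrite /c /c' exprS invfM; field; rewrite expf_neq0.
move=> D x y x1 y1; apply/ler_addgt0Pr => e e0.
have [n /ltW An] := geo_small (A - 128 * B) e0.
apply: le_trans (it n D x y x1 y1) _.
by rewrite lerD2l.
Qed.

End Grothendieck.

Section BoundedFunctions.
Variables (R : realType) (K : numFieldType) (S : scalars R K) (I : Type).
Local Notation toK := (toK S).
Local Notation ab := (ab S).
Local Notation nm := (nm S).

Definition bounded_family : {pred I -> K^o} :=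
  fun u => `[< exists B : R, forall i, ab (u i) <= B >].

Lemma bounded_family_submod_closed : submod_closed bounded_family.
Proof.
split=> [|a u v /asboolP[B uB] /asboolP[C vC]]; apply/asboolP.
  by exists 0 => i; rewrite ab0.
exists (ab a * B + C) => i; apply: le_trans (abD _ _ _) _.
by rewrite abM lerD // ler_wpM2l // ab_ge0.
Qed.

HB.instance Definition _ :=
  GRing.isSubmodClosed.Build K (I -> K^o) bounded_family
    bounded_family_submod_closed.

Record linf := Linf { linf_fun :> I -> K^o; _ : linf_fun \in bounded_family }.

HB.instance Definition _ := [isSub for linf_fun].
HB.instance Definition _ := [Choice of linf by <:].
HB.instance Definition _ := [SubChoice_isSubLmodule of linf by <:].

(** For empty I this is the supremum of the empty set, which is 0. *)
Definition linf_sup (u : linf) : R := sup (range (fun i => ab (u i))).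

Lemma linf_bounded (u : linf) : exists B : R, forall i, ab (u i) <= B.
Proof. by case: u => u ub /=; exact/asboolP. Qed.

Lemma ab_le_linf_sup (u : linf) i : ab (u i) <= linf_sup u.
Proof.
have [B uB] := linf_bounded u; apply: ub_le_sup; last by exists i.
by exists B => _ [j _ <-].
Qed.

Lemma linf_sup_le (u : linf) B :
  0 <= B -> (forall i, ab (u i) <= B) -> linf_sup u <= B.
Proof.
move=> B0 uB; rewrite /linf_sup.
have [->|/set0P ne] := eqVneq (range (fun i => ab (u i))) set0.
  by rewrite sup0.
by apply: ge_sup => // _ [i _ <-].
Qed.

Lemma linf_sup_ge0 (u : linf) : 0 <= linf_sup u.
Proof.
rewrite /linf_sup.
have [->|/set0P[_ [i _ _]]] := eqVneq (range (fun i => ab (u i))) set0.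
  by rewrite sup0.
exact: le_trans (ab_ge0 S (u i)) (ab_le_linf_sup u i).
Qed.

Definition linf_norm (u : linf) : K := toK (linf_sup u).

Lemma linf_normD (u v : linf) : linf_norm (u + v) <= linf_norm u + linf_norm v.
Proof.
rewrite -rmorphD toK_le linf_sup_le ?addr_ge0 ?linf_sup_ge0 // => i.
by apply: le_trans (abD _ _ _) _; rewrite lerD // ab_le_linf_sup.
Qed.

Lemma linf_normZ (a : K) (u : linf) : linf_norm (a *: u) = `|a| * linf_norm u.
Proof.
rewrite /linf_norm (normK S) -rmorphM; apply/(congr1 toK)/le_anti/andP; split.
  rewrite linf_sup_le ?mulr_ge0 ?linf_sup_ge0 ?ab_ge0 // => i.
  by rewrite abM ler_wpM2l ?ab_ge0 // ab_le_linf_sup.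
have [->|/eqP a0] := eqVneq a 0; first by rewrite ab0 mul0r linf_sup_ge0.
rewrite -ler_pdivlMl ?ab_gt0 // linf_sup_le ?mulr_ge0 ?invr_ge0 ?ab_ge0
    ?linf_sup_ge0 // => i.
by rewrite ler_pdivlMl ?ab_gt0 // -abM; exact: (ab_le_linf_sup (a *: u) i).
Qed.

Lemma linf_norm0_eq0 (u : linf) : linf_norm u = 0 -> u = 0.
Proof.
rewrite /linf_norm -(rmorph0 toK) => /toK_inj u0.
apply/val_inj/funext => i; apply: (@ab_eq0 _ _ S); apply/le_anti.
by rewrite ab_ge0 andbT -u0; exact: ab_le_linf_sup.
Qed.

HB.instance Definition _ :=
  @Lmodule_isNormed.Build K linf linf_norm linf_normD linf_normZ linf_norm0_eq0.

Lemma nm_linf (u : linf) : nm u = linf_sup u.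
Proof.
have uE : `|u| = toK (linf_sup u) by [].
by rewrite /nm uE ab_toK ger0_norm // linf_sup_ge0.
Qed.

(** A sequence x_n of centres of balls of radius 2^(-n) in the Cauchy filter
converges pointwise, at a uniform rate. *)
Lemma linf_complete (F : set_system linf) : ProperFilter F -> cauchy F -> cvg F.
Proof.
move=> FF /cauchyP Fc.
pose g n : R := (2 ^+ n)^-1.
have g0 n : 0 < g n by rewrite invr_gt0 exprn_gt0.
have ex n : exists x, F (ball x (toK (g n))).
  by apply: Fc; rewrite -(rmorph0 toK) toK_lt.
have [x hx] := choice ex.
have bE y (e : R) z : ball y (toK e) z = (nm (y - z) < e) :> Prop.
  by rewrite -ball_normE /ball_ /= (nmE S) toK_lt.
have xx n m : nm (x n - x m) <= g n + g m.
  have [y [/=]] := filter_ex (filterI (hx n) (hx m)).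
  rewrite !bE => h1 h2; apply: le_trans (nm_dist3 _ y _ _) _.
  by rewrite lerD // ltW // nm_distC.
have xi n m i : ab (x n i - x m i) <= g n + g m.
  by apply: le_trans (xx n m); rewrite nm_linf; exact: (ab_le_linf_sup (x n - x m) i).
have gle m n : (m <= n)%N -> g n <= g m.
  by move=> mn; rewrite lef_pV2 ?posrE ?exprn_gt0 // ler_weXn2l // ler1n.
have gsmall e : 0 < e -> exists N, g N < e.
  by move=> /(geo_small 1)[N]; rewrite div1r; exists N.
have exl i : exists l, forall e, 0 < e ->
    exists N, forall n, (N <= n)%N -> ab (x n i - l) <= e.
  apply: scalar_complete => e e0; have [|N Ne] := gsmall (e / 2); first by
      rewrite divr_gt0.
  exists N => n Nn; apply: le_trans (xi n N i) _.
  by rewrite [leRHS]splitr lerD // ?ltW // (le_lt_trans (gle _ _ Nn)).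
have [y hy] := choice exl.
have xy n i : ab (x n i - y i) <= 2 * g n.
  apply/ler_addgt0Pr => e e0; have [N hN] := hy i e e0.
  pose m := maxn n N.
  have -> : x n i - y i = (x n i - x m i) + (x m i - y i) by ring.
  apply: le_trans (abD _ _ _) _; apply: lerD; last by apply: hN; exact: leq_maxr.
  apply: le_trans (xi n m i) _; rewrite mulr_natl mulr2n lerD2l.
  by apply: gle; exact: leq_maxl.
have yb : (y : I -> K^o) \in bounded_family.
  apply/asboolP; have [B xB] := linf_bounded (x 0%N); exists (B + 2 * g 0%N) => i.
  have -> : y i = x 0%N i - (x 0%N i - y i) by ring.
  by apply: le_trans (abD _ _ _) _; rewrite abN lerD.
pose Y := Linf yb.
have xY n : nm (x n - Y) <= 2 * g n.
  rewrite nm_linf linf_sup_le ?mulr_ge0 // ?ltW // => i.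
  exact: xy.
apply/cvg_ex; exists Y => A /(nbhs_nm S)[d d0 dA].
have [|n nd] := gsmall (d / 4); first by rewrite divr_gt0.
apply: filterS (hx n) => z; rewrite bE => xz; apply: dA.
apply: le_lt_trans (nm_dist3 _ (x n) _ _) _; rewrite nm_distC.
by have := xY n; lra.
Qed.

HB.instance Definition _ := Uniform_isComplete.Build linf linf_complete.

End BoundedFunctions.

Section GrothendieckLinf.
Variables (R : realType) (K : numFieldType) (S : scalars R K).
Variables (I : Type) (i0 : I).
Local Notation toK := (toK S).
Local Notation re := (re S).
Local Notation im := (im S).
Local Notation ab := (ab S).
Local Notation nm := (nm S).
Local Notation E := (linf S I).

Definition real_fun (f : I -> R) : E :=
  insubd (0 : E) ((fun i => toK (f i)) : I -> K^o).

Lemma real_funE f i : (forall i, `|f i| <= 1) -> real_fun f i = toK (f i).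
Proof.
move=> f1; have fb : ((fun i => toK (f i)) : I -> K^o) \in @bounded_family _ _ S I.
  by apply/asboolP; exists 1 => j; rewrite ab_toK.
by have := insubdK (0 : E) fb; rewrite /real_fun => /(congr1 (fun g : I -> K^o => g i)).
Qed.

Lemma nm_real_fun_le f e : 0 <= e -> (forall i, `|f i| <= 1) ->
  (forall i, `|f i| <= e) -> nm (real_fun f) <= e.
Proof.
move=> e0 f1 fe; rewrite nm_linf linf_sup_le // => i.
by rewrite real_funE // ab_toK.
Qed.

(** The cell of i records, for each d, in which interval of length 1/n the value
of f d at i lies; values are shifted by 1 as they range over [-1, 1]. *)
Definition cell (D : finType) (n : nat) (f : D -> I -> R) (i : I) :
    {ffun D -> 'I_(2 * n).+1} :=
  [ffun d => inord (Num.truncn ((f d i + 1) * n%:R))].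

Lemma cell_close (D : finType) (n : nat) (f : D -> I -> R) (i j : I) d :
  (0 < n)%N -> (forall d i, `|f d i| <= 1) -> cell n f i = cell n f j ->
  `|f d i - f d j| <= n%:R^-1.
Proof.
move=> n0 f1 /ffunP/(_ d); rewrite !ffunE => /(congr1 val).
have n0R : 0 < n%:R :> R by rewrite ltr0n.
have bnd k : 0 <= (f d k + 1) * n%:R <= (2 * n)%:R.
  have := f1 d k; rewrite ler_norml natrM => /andP[h1 h2].
  by apply/andP; split; [apply: mulr_ge0; [lra|exact: ltW]|rewrite ler_pM2r //; lra].
have tr k : (Num.truncn ((f d k + 1) * n%:R) < (2 * n).+1)%N.
  have /andP[h1 h2] := bnd k.
  rewrite ltnS -(ler_nat R); apply: le_trans h2.
  by rewrite truncn_le.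
rewrite /= !inordK // => ij.
have /andP[i1 _] := bnd i; have /andP[j1 _] := bnd j.
have /andP[h1 h2] := truncn_itv i1; have /andP[h3 h4] := truncn_itv j1.
rewrite ij -natr1 in h1 h2; rewrite -natr1 in h4.
rewrite -(ler_pM2r n0R) mulVf ?gt_eqF // -(gtr0_norm n0R) -normrM.
rewrite ler_norml.
have -> : (f d i - f d j) * n%:R = (f d i + 1) * n%:R - (f d j + 1) * n%:R by ring.
by apply/andP; split; lra.
Qed.

Section Form.
Variables (T : E -> E -> K) (c : R) (tau : K -> R).
Hypothesis Tc : bform S c T.
Hypothesis c0 : 0 <= c.
Hypothesis tauD : {morph tau : z w / z + w}.
Hypothesis tauZ : forall r z, tau (toK r * z) = r * tau z.
Hypothesis tau_le : forall z, `|tau z| <= ab z.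

Lemma tau_sum J (r : seq J) (P : pred J) (F : J -> K) :
  tau (\sum_(j <- r | P j) F j) = \sum_(j <- r | P j) tau (F j).
Proof.
apply: (big_morph tau tauD).
by have := tauZ 0 0; rewrite mulr0 mul0r.
Qed.

(** Replaces functions on I by functions constant on finitely many cells, so
that a form on bounded functions becomes a finite matrix. The constants are
values taken by f itself, on representatives of the cells: thus quadratic
bounds on f remain true after the replacement. *)
Lemma discretization (D : finType) (n : nat) (f : D -> I -> R) :
  (0 < n)%N -> (forall d i, `|f d i| <= 1) ->
  exists (L : finType) (rep : L -> I) (chi : L -> E),
    [/\ forall (u : L -> R), (forall l, `|u l| <= 1) ->
          nm (\sum_l toK (u l) *: chi l) <= 1 &
      forall d, nm (real_fun (f d) - \sum_l toK (f d (rep l)) *: chi l) <= n%:R^-1].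
Proof.
move=> n0 f1; pose L := {ffun D -> 'I_(2 * n).+1}.
have ex (l : L) : exists i, (exists j, cell n f j = l) -> cell n f i = l.
  have [[j jl]|nj] := pselect (exists j, cell n f j = l); first by exists j.
  by exists i0.
have [rep hrep] := choice ex.
pose chi (l : L) := real_fun (fun i => (cell n f i == l)%:R).
have chiE l i : chi l i = toK (cell n f i == l)%:R.
  by apply: real_funE => j; case: (_ == _); rewrite ?normr1 ?normr0.
have sumE (u : L -> R) i : (\sum_l toK (u l) *: chi l) i = toK (u (cell n f i)).
  have -> : (\sum_l toK (u l) *: chi l) i = \sum_l toK (u l) * chi l i.
    by elim/big_ind2: _ => // x1 x2 y1 y2 <- <-.
  rewrite (bigD1 (cell n f i)) //= chiE eqxx rmorph1 mulr1 big1 ?addr0 // => l /negbTE.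
  by rewrite chiE eq_sym => ->; rewrite rmorph0 mulr0.
exists L, rep, chi; split=> [u u1|d].
  by rewrite nm_linf linf_sup_le // => i; rewrite sumE ab_toK.
rewrite nm_linf linf_sup_le ?invr_ge0 // => i.
have -> : (real_fun (f d) - \sum_l toK (f d (rep l)) *: chi l) i =
    real_fun (f d) i - (\sum_l toK (f d (rep l)) *: chi l) i by [].
rewrite sumE real_funE // -rmorphB ab_toK; apply: cell_close => //.
by rewrite hrep //; exists i.
Qed.

(** tau stands for the real or the imaginary part. The constant of the finite
inequality does not depend on the number of cells, and the discretization error
tends to 0. *)
Lemma grothendieck_real (D : finType) (f g : D -> I -> R) :
  (forall i, \sum_d f d i ^+ 2 <= 1) -> (forall i, \sum_d g d i ^+ 2 <= 1) ->
  `|\sum_d tau (T (real_fun (f d)) (real_fun (g d)))| <= 128 * c.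
Proof.
have le1 (h : D -> I -> R) : (forall i, \sum_d h d i ^+ 2 <= 1) ->
    forall d i, `|h d i| <= 1.
  move=> h1 d i; have := h1 i; rewrite (bigD1 d) //= => hd.
  rewrite -(@ler_pXn2r _ 2%N) ?nnegrE // real_normK ?num_real // expr1n.
  apply: le_trans hd; rewrite lerDl.
  by apply: sumr_ge0 => k _; exact: sqr_ge0.
move=> f2 g2; have f1 := le1 _ f2; have g1 := le1 _ g2.
have [Tl Tr Tb] := Tc; have [TsumL TsumR] := bform_sum Tc.
have [TZl TZr] := bform_scale Tc.
apply/ler_addgt0Pr => e e0.
pose A := 2 * c * #|D|%:R.
have A0 : 0 <= A by rewrite !mulr_ge0.
pose n := (Num.truncn (A / e)).+1.
have n0 : 0 < n%:R :> R by rewrite ltr0n.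
have An : A * n%:R^-1 <= e.
  rewrite ler_pdivrMr // mulrC -ler_pdivrMr //; exact/ltW/truncnS_gt.
have [L [rep [chi [chi1 fchi]]]] := discretization (ltn0Sn _ : (0 < n)%N) f1.
have [L' [rep' [chi' [chi'1 gchi]]]] := discretization (ltn0Sn _ : (0 < n)%N) g1.
pose F d := \sum_l toK (f d (rep l)) *: chi l.
pose G d := \sum_l toK (g d (rep' l)) *: chi' l.
have TE (u : L -> R) (v : L' -> R) :
    tau (T (\sum_l toK (u l) *: chi l) (\sum_l toK (v l) *: chi' l)) =
    \sum_l \sum_l' tau (T (chi l) (chi' l')) * (u l * v l').
  rewrite TsumL tau_sum; apply: eq_bigr => l _.
  rewrite TsumR tau_sum; apply: eq_bigr => l' _.
  by rewrite TZl TZr mulrCA !tauZ; ring.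
have sB (u : L -> R) (v : L' -> R) :
    (forall l, `|u l| <= 1) -> (forall l, `|v l| <= 1) ->
    `|\sum_l \sum_l' tau (T (chi l) (chi' l')) * (u l * v l')| <= c.
  move=> u1 v1; rewrite -TE; apply: le_trans (tau_le _) _.
  apply: le_trans (Tb _ _) _; rewrite -[leRHS]mulr1.
  apply: ler_pM; rewrite ?mulr_ge0 ?nm_ge0 ?chi'1 //.
  by rewrite -[leRHS]mulr1 ler_wpM2l // chi1.
have := grothendieck_finite sB (x := fun l d => f d (rep l))
  (y := fun l d => g d (rep' l)) (fun l => f2 _) (fun l => g2 _).
rewrite (_ : \sum_l _ = \sum_d tau (T (F d) (G d))); last first.
  rewrite (eq_bigr _ (fun d _ => TE (fun l => f d (rep l)) (fun l => g d (rep' l)))).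
  rewrite [RHS]exchange_big; apply: eq_bigr => l _ /=.
  rewrite [RHS]exchange_big; apply: eq_bigr => l' _ /=.
  by rewrite mulr_sumr.
move=> main.
have err d : `|tau (T (real_fun (f d)) (real_fun (g d))) - tau (T (F d) (G d))|
    <= 2 * c * n%:R^-1.
  have tauN z : tau (- z) = - tau z by have := tauZ (-1) z; rewrite rmorphN1 !mulN1r.
  rewrite -tauN -tauD; apply: le_trans (tau_le _) _.
  have -> : T (real_fun (f d)) (real_fun (g d)) - T (F d) (G d) =
      T (real_fun (f d) - F d) (real_fun (g d)) + T (F d) (real_fun (g d) - G d).
    have -> : T (real_fun (f d) - F d) (real_fun (g d)) =
        T (real_fun (f d)) (real_fun (g d)) - T (F d) (real_fun (g d)).
      by have := Tl (-1) (F d) (real_fun (f d)) (real_fun (g d)); rewrite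
          scaleN1r addrC => ->; ring.
    have -> : T (F d) (real_fun (g d) - G d) =
        T (F d) (real_fun (g d)) - T (F d) (G d).
      by have := Tr (-1) (F d) (G d) (real_fun (g d)); rewrite scaleN1r addrC
          => ->; ring.
    by ring.
  apply: le_trans (abD _ _ _) _.
  have -> : 2 * c * n%:R^-1 = c * n%:R^-1 * 1 + c * 1 * n%:R^-1 by ring.
  apply: lerD; apply: le_trans (Tb _ _) _.
    apply: ler_pM; rewrite ?mulr_ge0 ?nm_ge0 //; first by rewrite ler_wpM2l.
    exact: nm_real_fun_le.
  apply: ler_pM; rewrite ?mulr_ge0 ?nm_ge0 //.
  by rewrite ler_wpM2l // chi1.
have -> : \sum_d tau (T (real_fun (f d)) (real_fun (g d))) =
    \sum_d tau (T (F d) (G d)) +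
    \sum_d (tau (T (real_fun (f d)) (real_fun (g d))) - tau (T (F d) (G d))).
  by rewrite -big_split /=; apply: eq_bigr => d _; rewrite addrC subrK.
apply: le_trans (ler_normD _ _) _; apply: lerD => //.
apply: le_trans (ler_norm_sum _ _ _) _; apply: le_trans An.
have -> : A * n%:R^-1 = \sum_(d : D) 2 * c * n%:R^-1.
  by rewrite sumr_const -[RHS]mulr_natr /A; ring.
exact: ler_sum.
Qed.

End Form.

(** Splitting the vectors and the values of the form into real and imaginary
parts leaves eight real sums, each at most 128 c. *)
Theorem grothendieck_linf (T : E -> E -> K) (c : R) (D : finType) (x y : D -> E) :
  0 <= c -> bform S c T ->
  (forall i, \sum_d ab (x d i) ^+ 2 <= 1) ->
  (forall i, \sum_d ab (y d i) ^+ 2 <= 1) ->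
  ab (\sum_d T (x d) (y d)) <= 1024 * c.
Proof.
move=> c0 Tc x2 y2.
have [Tl Tr Tb] := Tc; have [TZl TZr] := bform_scale Tc.
have real2 (z : D -> E) : (forall i, \sum_d ab (z d i) ^+ 2 <= 1) ->
    (forall i, \sum_d re (z d i) ^+ 2 <= 1) /\
    (forall i, \sum_d im (z d i) ^+ 2 <= 1).
  move=> z2; split=> i; apply: le_trans (z2 i); apply: ler_sum => d _;
  by rewrite sqr_ab ?lerDl ?lerDr sqr_ge0.
have [xr xi] := real2 _ x2; have [yr yi] := real2 _ y2.
have split_reim (z : D -> E) d : (forall i, \sum_d ab (z d i) ^+ 2 <= 1) ->
    z d = iu S *: real_fun (fun i => im (z d i)) + real_fun (fun i => re (z d i)).
  move=> z2; apply/val_inj/funext => i.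
  have z1 j : ab (z d j) <= 1.
    rewrite -(@ler_pXn2r _ 2%N) ?nnegrE ?ab_ge0 // expr1n.
    apply: le_trans (z2 j); rewrite (bigD1 d) //= lerDl.
    by apply: sumr_ge0 => k _; exact: sqr_ge0.
  have -> : val (iu S *: real_fun (fun i => im (z d i)) +
      real_fun (fun i => re (z d i))) i =
      iu S * real_fun (fun i => im (z d i)) i + real_fun (fun i => re (z d i)) i.
    by [].
  rewrite !real_funE; last 2 first.
  - by move=> j; exact: le_trans (re_le_ab _ _) (z1 j).
  - by move=> j; exact: le_trans (im_le_ab _ _) (z1 j).
  by rewrite addrC -scalarE.
have part (f g : D -> I -> R) :
    (forall i, \sum_d f d i ^+ 2 <= 1) -> (forall i, \sum_d g d i ^+ 2 <= 1) ->
    ab (\sum_d T (real_fun (f d)) (real_fun (g d))) <= 256 * c.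
  move=> f2 g2; apply: le_trans (ab_le_reim _ _) _; rewrite re_sum im_sum.
  have -> : 256 * c = 128 * c + 128 * c by ring.
  apply: lerD.
    apply: (grothendieck_real (tau := re) Tc c0 (reD S)) => //.
      exact: reZ.
    exact: re_le_ab.
  apply: (grothendieck_real (tau := im) Tc c0 (imD S)) => //.
    exact: imZ.
  exact: im_le_ab.
pose a d := real_fun (fun i => re (x d i)); pose b d := real_fun (fun i => im (x d i)).
pose a' d := real_fun (fun i => re (y d i)); pose b' d := real_fun (fun i => im
    (y d i)).
have -> : \sum_d T (x d) (y d) =
    iu S * (iu S * \sum_d T (b d) (b' d) + \sum_d T (b d) (a' d)) +
    (iu S * \sum_d T (a d) (b' d) + \sum_d T (a d) (a' d)).
  rewrite !mulr_sumr -!big_split /= mulr_sumr -big_split /=.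
  apply: eq_bigr => d _.
  by rewrite (split_reim _ _ x2) (split_reim _ _ y2) Tl !Tr.
have iu1 z B : ab z <= B -> ab (iu S * z) <= B.
  by move=> zB; apply: le_trans zB; rewrite abM ler_piMl ?ab_ge0 // ab_iu.
have -> : 1024 * c = (256 * c + 256 * c) + (256 * c + 256 * c) by ring.
apply: le_trans (abD _ _ _) _; apply: lerD.
  by apply: (iu1); apply: le_trans (abD _ _ _) _; apply: lerD; [apply: (iu1)|];
      exact: part.
by apply: le_trans (abD _ _ _) _; apply: lerD; [apply: (iu1)|]; exact: part.
Qed.

End GrothendieckLinf.

(** * Unconditional bases *)

Section System.
Variables (R : realType) (K : numFieldType) (S : scalars R K).
Variable X : normedModType K.
Local Notation ab := (ab S).
Local Notation nm := (nm S).

(** A normalized unconditional basis e_n with coordinate functionals f_n, in the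
form in which it is used: bounded multipliers act on expansions with norm at
most U. *)
Record unconditional_system (e : nat -> X) (f : nat -> X -> K) (U : R) : Prop := {
  us_linear : forall n a x y, f n (a *: x + y) = a * f n x + f n y;
  us_biorth : forall n m, f n (e m) = (n == m)%:R;
  us_norm1 : forall n, nm (e n) = 1;
  us_mult : forall (th : nat -> K) N x, (forall n, ab (th n) <= 1) ->
    nm (\sum_(n < N) (th n * f n x) *: e n) <= U * nm x;
  us_cvg : forall x (d : R), 0 < d -> exists N0, forall N, (N0 <= N)%N ->
    nm (\sum_(n < N) f n x *: e n - x) < d }.

End System.

Section Rearrangement.
Variables (p : nat -> nat) (m : nat -> pred nat).
Hypothesis p0 : p 0%N = 0%N.
Hypothesis pS : forall j, (p j < p j.+1)%N.

Definition block_iota j := iota (p j) (p j.+1 - p j).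

(** The integers of [p j, p j.+1), those selected by the mask m j coming
first. *)
Definition block_list j :=
  [seq n <- block_iota j | m j n] ++ [seq n <- block_iota j | ~~ m j n].

Fixpoint block_prefix j : seq nat :=
  if j is i.+1 then block_prefix i ++ block_list i else [::].

Definition rearrangement n := nth 0%N (block_prefix n.+1) n.

Lemma perm_block_prefix j : perm_eq (block_prefix j) (iota 0 (p j)).
Proof.
elim: j => [|j IH] /=; first by rewrite p0.
have -> : iota 0 (p j.+1) = iota 0 (p j) ++ block_iota j.
  by rewrite /block_iota -iotaD subnKC // ltnW.
by apply: perm_cat => //; rewrite perm_filterC.
Qed.

Lemma size_block_prefix j : size (block_prefix j) = p j.
Proof. by rewrite (perm_size (perm_block_prefix j)) size_iota. Qed.

Lemma leq_block_start j : (j <= p j)%N.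
Proof. by elim: j => // j /leq_ltn_trans; apply. Qed.

Lemma block_prefix_nth i j n : (i <= j)%N -> (n < p i)%N ->
  nth 0%N (block_prefix j) n = nth 0%N (block_prefix i) n.
Proof.
move=> /subnK <- ni; elim: (j - i)%N => // k IH.
rewrite addSn /= nth_cat IH size_block_prefix ifT //.
apply: leq_trans ni _.
by elim: k {IH} => // k /leq_trans; apply; rewrite addSn ltnW.
Qed.

Lemma rearrangementE j n : (n < p j)%N ->
  rearrangement n = nth 0%N (block_prefix j) n.
Proof.
move=> nj; rewrite /rearrangement.
have nn : (n < p n.+1)%N by exact: leq_block_start.
have [jn|jn] := leqP j n.+1; first by rewrite (block_prefix_nth jn).
by rewrite -(block_prefix_nth (ltnW jn)).
Qed.

Lemma rearrangement_bij : bijective rearrangement.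
Proof.
pose g x := index x (block_prefix x.+1).
have gP x : (g x < p x.+1)%N /\ rearrangement (g x) = x.
  have xin : x \in block_prefix x.+1.
    by rewrite (perm_mem (perm_block_prefix _)) mem_iota leq_block_start.
  have gx : (g x < p x.+1)%N by rewrite -size_block_prefix index_mem.
  by split=> //; rewrite (rearrangementE gx) nth_index.
have inj : injective rearrangement.
  move=> a b; pose k := maxn a.+1 b.+1.
  have ak : (a < p k)%N by apply: leq_trans (leq_block_start _); exact: leq_maxl.
  have bk : (b < p k)%N by apply: leq_trans (leq_block_start _); exact: leq_maxr.
  rewrite (rearrangementE ak) (rearrangementE bk) => /eqP.
  rewrite nth_uniq ?size_block_prefix //; first by move/eqP.
  by rewrite (perm_uniq (perm_block_prefix k)) iota_uniq.
exists g => [n|x]; last by have [] := gP x.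
by apply: inj; have [] := gP (rearrangement n).
Qed.

Lemma rearrangement_sum (V : zmodType) (v : nat -> V) j q : (q <= p j)%N ->
  \sum_(0 <= k < q) v (rearrangement k) = \sum_(x <- take q (block_prefix j)) v x.
Proof.
move=> qj; have -> : take q (block_prefix j) = map rearrangement (iota 0 q).
  apply: (@eq_from_nth _ 0%N) => [|n].
    by rewrite size_takel ?size_block_prefix // size_map size_iota.
  rewrite size_takel ?size_block_prefix // => nq.
  by rewrite nth_take // (nth_map 0%N) ?size_iota // nth_iota //
      -rearrangementE // (leq_trans nq).
by rewrite big_map /index_iota subn0.
Qed.

(** A sum over masked indices appears as a difference of partial sums of the
rearranged series. *)
Lemma rearrangement_gap (V : zmodType) (v : nat -> V) j :
  \sum_(0 <= k < p j + size ([seq n <- block_iota j | m j n])) v (rearrangement k) -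
  \sum_(0 <= k < p j) v (rearrangement k) =
  \sum_(p j <= n < p j.+1 | m j n) v n.
Proof.
set c := size _.
have cp : (p j + c <= p j.+1)%N.
  rewrite -leq_subRL; last exact: ltnW.
  by rewrite /c size_filter (leq_trans (count_size _ _)) // size_iota.
rewrite (rearrangement_sum v cp) (rearrangement_sum v (leqnn (p j))).
rewrite /= -{1}(size_block_prefix j) takeD take_size_cat // drop_size_cat //.
rewrite take_size_cat // take_oversize ?size_block_prefix //.
by rewrite big_cat /= addrAC subrr add0r big_filter.
Qed.

End Rearrangement.

Section MasksBounded.
Variables (R : realType) (K : numFieldType) (S : scalars R K).
Variable X : normedModType K.
Local Notation nm := (nm S).

(** Otherwise there are consecutive intervals containing masked sums of norm
larger than 1, and the rearrangement that puts the masked indices first in each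
interval is not Cauchy. *)
Lemma unconditional_masks_bounded (v : nat -> X) :
  unconditionally_convergent v ->
  exists B : R, forall N (m : pred nat), nm (\sum_(n < N | m n) v n) <= B.
Proof.
move=> vc; apply: contrapT => nB.
have gap N0 : exists q : nat * pred nat, (N0 < q.1)%N /\
    1 < nm (\sum_(N0 <= n < q.1 | q.2 n) v n).
  apply: contrapT => ngap; apply: nB.
  have partial N (m : pred nat) : (N <= N0)%N ->
      nm (\sum_(0 <= n < N | m n) v n) <= \sum_(0 <= n < N0) nm (v n).
    move=> NN0; apply: le_trans (nm_sum _ _ _ _) _.
    apply: (@le_trans _ _ (\sum_(0 <= n < N) nm (v n))).
      rewrite big_mkcond; apply: ler_sum => n _.
      by case: ifP => // _; exact: nm_ge0.
    rewrite [leRHS](big_cat_nat (leq0n N) NN0) //= lerDl sumr_ge0 // => n _;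
        exact: nm_ge0.
  exists (1 + \sum_(0 <= n < N0) nm (v n)) => N m.
  rewrite -(big_mkord m v).
  have [NN0|NN0] := leqP N N0; first by apply: le_trans (partial _ _ NN0) _;
      rewrite lerDr.
  rewrite (big_cat_nat (leq0n N0) (ltnW NN0)) //= addrC; apply: le_trans (nmD _ _ _) _.
  apply: lerD; last exact: partial.
  by rewrite leNgt; apply/negP => h; apply: ngap; exists (N, m).
have [q hq] := choice gap.
pose p := fix p j := if j is i.+1 then (q (p i)).1 else 0%N.
pose m j := (q (p j)).2.
have pS j : (p j < p j.+1)%N by have [] := hq (p j).
have := vc _ (@rearrangement_bij p m erefl pS).
move=> /(cvgn_cauchy_nm S)/(_ 1 ltr01)[N hN].
have pN : (N <= p N)%N by exact: leq_block_start.
have := hN (p N + size ([seq n <- block_iota p N | m N n]))%N (p N)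
  (leq_trans pN (leq_addr _ _)) pN.
rewrite /series /= (rearrangement_gap m erefl pS v N).
by apply/negP; rewrite -leNgt ltW //; have [] := hq (p N).
Qed.

(** The multiplier t_N is a convex combination of 1 and 0, that is, of keeping
and dropping the index N. The vector w carries the terms already treated. *)
Lemma masks_multipliers_real (v : nat -> X) (k : R) N (w : X) (t : nat -> R) :
  (forall m : pred nat, nm (w + \sum_(n < N | m n) v n) <= k) ->
  (forall n, 0 <= t n <= 1) ->
  nm (w + \sum_(n < N) toK S (t n) *: v n) <= k.
Proof.
move=> + t01; elim: N w => [|N IH] w h.
  by have := h predT; rewrite !big_ord0.
have hN (m : pred nat) :
    nm (w + \sum_(n < N | m n) v n) <= k /\
    nm (w + v N + \sum_(n < N | m n) v n) <= k.
  split.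
    have := h (fun n => m n && (n < N)%N); rewrite big_mkcond big_ord_recr /=
        ltnn andbF addr0.
    rewrite [\sum_(n < N | m n) _]big_mkcond /=.
    by under eq_bigr => n _ do rewrite ltn_ord andbT.
  have := h (fun n => (n == N) || m n); rewrite big_mkcond big_ord_recr /= eqxx /=.
  rewrite [\sum_(n < N | m n) _]big_mkcond /= addrA addrAC.
  by under eq_bigr => n _ do rewrite ltn_eqF ?ltn_ord //=.
rewrite big_ord_recr /= addrA addrAC.
apply: IH => m; have [h1 h2] := hN m; have /andP[t0 t1] := t01 N.
have -> : w + toK S (t N) *: v N + \sum_(n < N | m n) v n =
    toK S (t N) *: (w + v N + \sum_(n < N | m n) v n) +
    toK S (1 - t N) *: (w + \sum_(n < N | m n) v n).
  set A := \sum_(n < N | m n) v n.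
  have -> : w + v N + A = v N + (w + A) by rewrite addrAC addrC.
  rewrite rmorphB rmorph1 scalerBl scale1r scalerDr -[RHS]addrA.
  by rewrite [toK S (t N) *: (w + A) + _]addrC subrK addrAC addrC.
apply: le_trans (nmD _ _ _) _; rewrite !nmZ !ab_toK !ger0_norm ?subr_ge0 //.
have : t N * nm (w + v N + \sum_(n < N | m n) v n) <= t N * k by rewrite ler_wpM2l.
have : (1 - t N) * nm (w + \sum_(n < N | m n) v n) <= (1 - t N) * k.
  by rewrite ler_wpM2l ?subr_ge0.
lra.
Qed.

(** A scalar of modulus at most 1 is a combination of four numbers in [0, 1], the
positive and negative parts of its real and imaginary parts. *)
Lemma masks_multipliers (v : nat -> X) (k : R) N (th : nat -> K) :
  (forall m : pred nat, nm (\sum_(n < N | m n) v n) <= k) ->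
  (forall n, ab S (th n) <= 1) ->
  nm (\sum_(n < N) th n *: v n) <= 4 * k.
Proof.
move=> h th1.
have part (t : nat -> R) : (forall n, 0 <= t n <= 1) ->
    nm (\sum_(n < N) toK S (t n) *: v n) <= k.
  move=> t01; have := @masks_multipliers_real v k N 0 t; rewrite add0r; apply=> // m.
  by rewrite add0r.
have signed (t : nat -> R) : (forall n, `|t n| <= 1) ->
    nm (\sum_(n < N) toK S (t n) *: v n) <= 2 * k.
  move=> t1; pose tp n := Num.max (t n) 0; pose tn n := Num.max (- t n) 0.
  have tE n : t n = tp n - tn n.
    rewrite /tp /tn; have /orP[h0|h0] := le_total 0 (t n).
      by rewrite max_l // max_r ?oppr_le0 // subr0.
    by rewrite max_r // max_l ?oppr_ge0 // sub0r opprK.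
  have -> : \sum_(n < N) toK S (t n) *: v n =
      \sum_(n < N) toK S (tp n) *: v n - \sum_(n < N) toK S (tn n) *: v n.
    by rewrite -sumrB; apply: eq_bigr => n _; rewrite -scalerBl -rmorphB -tE.
  apply: le_trans (nmB _ _ _) _; rewrite mulr_natl mulr2n.
  by apply: lerD; apply: part => n; have := t1 n;
    rewrite ler_norml /tp /tn le_max lexx orbT ge_max ler01 andbT; lra.
have -> : \sum_(n < N) th n *: v n =
    \sum_(n < N) toK S (re S (th n)) *: v n +
    iu S *: \sum_(n < N) toK S (im S (th n)) *: v n.
  rewrite scaler_sumr -big_split /=; apply: eq_bigr => n _.
  by rewrite scalerA -scalerDl -scalarE.
have -> : 4 * k = 2 * k + 2 * k by ring.
apply: le_trans (nmD _ _ _) _; apply: lerD.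
  exact: (signed (fun n => re S (th n))
    (fun n => le_trans (re_le_ab S (th n)) (th1 n))).
have := signed (fun n => im S (th n))
  (fun n => le_trans (im_le_ab S (th n)) (th1 n)).
by rewrite nmZ; apply: le_trans; rewrite ler_piMl ?nm_ge0 ?ab_iu.
Qed.

End MasksBounded.

Section Baire.
Variables (R : realType) (K : numFieldType) (S : scalars R K).
Variable X : completeNormedModType K.
Local Notation nm := (nm S).

(** Baire's theorem over the scalar field K: one of the sets D k is dense in some
ball. Otherwise one constructs nested balls, the k-th of which avoids D k. *)
Lemma baire_dense_ball (D : nat -> set X) : (forall x, exists k, D k x) ->
  exists k x (r : R), 0 < r /\ forall y, nm (x - y) < r ->
    forall d : R, 0 < d -> exists z, D k z /\ nm (y - z) < d.
Proof.
move=> covD; apply: contrapT => nD.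
have step (q : nat * (X * R)) : exists q' : X * R, 0 < q.2.2 ->
    [/\ 0 < q'.2, q'.2 <= q.2.2 / 2, nm (q.2.1 - q'.1) + q'.2 <= q.2.2 &
        forall z, D q.1 z -> q'.2 < nm (q'.1 - z)].
  have [r0|r0] := ltP 0 q.2.2; last by exists (0, 0).
  apply: contrapT => nq; apply: nD; exists q.1, q.2.1, q.2.2; split=> // y yr d d0.
  apply: contrapT => nz; apply: nq.
  exists (y, Num.min (d / 2) (Num.min (q.2.2 / 2) (q.2.2 - nm (q.2.1 - y)))) => _ /=.
  split.
  - by rewrite !lt_min !divr_gt0 // subr_gt0.
  - by rewrite !ge_min lexx orbT.
  - by rewrite -lerBrDl !ge_min lexx !orbT.
  - move=> z Dz; apply: (@lt_le_trans _ _ d).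
      by rewrite gt_min ltr_pdivrMr // ltr_pMr // ltr1n.
    by rewrite leNgt; apply/negP => zd; apply: nz; exists z.
have [nxt hnxt] := choice step.
pose b := fix b n : X * R := if n is k.+1 then nxt (k, b k) else (0, 1).
have b0 n : 0 < (b n).2.
  by elim: n => [|n IH] //=; have [] := hnxt (n, b n) IH.
have bS n := hnxt (n, b n) (b0 n).
have nested n k : nm ((b n).1 - (b (n + k)%N).1) + (b (n + k)%N).2 <= (b n).2.
  elim: k => [|k IH]; first by rewrite addn0 subrr nm0 add0r.
  rewrite addnS; have [_ _ h _] := bS (n + k)%N.
  apply: le_trans IH; rewrite -[(nxt _)]/(b (n + k).+1) in h.
  have := nm_dist3 S (b (n + k)%N).1 (b n).1 (b (n + k).+1).1.
  by move: h; rewrite /=; lra.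
have rsmall n : (b n).2 <= 1 / 2 ^+ n.
  elim: n => [|n IH]; first by rewrite expr0 divr1.
  have [_ h _ _] := bS n; rewrite -[(nxt _)]/(b n.+1) in h.
  apply: le_trans h _.
  have -> : 1 / 2 ^+ n.+1 = 1 / 2 ^+ n / 2 :> R.
    by rewrite exprS; field; rewrite expf_neq0.
  by rewrite ler_pM2r ?invr_gt0.
have : cvgn (fun n => (b n).1).
  apply: (cauchy_nm (S := S)) => d d0; have [N hN] := geo_small 1 d0.
  exists N => n /subnKC <-; rewrite nm_distC; apply: le_lt_trans hN.
  apply: le_trans (rsmall N); apply: le_trans (nested N (n - N)%N).
  by rewrite lerDl ltW.
move=> /(cvg_nm S) bl; set l := limn _ in bl.
have [k Dl] := covD l.
have [_ _ _ /(_ l Dl)] := bS k; rewrite -[(nxt _)]/(b k.+1).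
apply/negP; rewrite -leNgt; apply/ler_addgt0Pr => d d0.
have [N hN] := bl d d0; pose n := maxn N k.+1.
have := hN n (leq_maxl _ _).
have := nested k.+1 (n - k.+1)%N; rewrite subnKC ?leq_maxr //.
have := nm_dist3 S (b n).1 (b k.+1).1 l.
by have := b0 n; rewrite /=; lra.
Qed.

End Baire.

Section SchauderBasis.
Variables (R : realType) (K : numFieldType) (S : scalars R K).
Variable X : completeNormedModType K.
Local Notation toK := (toK S).
Local Notation ab := (ab S).
Local Notation nm := (nm S).
Variables (e : nat -> X) (c : X -> nat -> K).
Hypothesis ccvg : forall x (d : R), 0 < d -> exists N0, forall N, (N0 <= N)%N ->
  nm (\sum_(n < N) c x n *: e n - x) < d.
Hypothesis cuniq : forall x (b : nat -> K),
  (forall d : R, 0 < d -> exists N0, forall N, (N0 <= N)%N ->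
    nm (\sum_(n < N) b n *: e n - x) < d) -> c x = b.

Lemma coord_linear a x y n : c (a *: x + y) n = a * c x n + c y n.
Proof.
rewrite (@cuniq (a *: x + y) (fun n => a * c x n + c y n)) // => d d0.
have a1 : 0 < ab a + 1 by rewrite ltr_wpDl // ab_ge0.
have [|N1 h1] := ccvg x (d := d / 2 / (ab a + 1)); first by rewrite !divr_gt0.
have [|N2 h2] := ccvg y (d := d / 2); first by rewrite divr_gt0.
exists (maxn N1 N2) => N; rewrite geq_max => /andP[/h1 {}h1 /h2 {}h2].
have -> : \sum_(n < N) (a * c x n + c y n) *: e n - (a *: x + y) =
    a *: (\sum_(n < N) c x n *: e n - x) + (\sum_(n < N) c y n *: e n - y).
  rewrite scalerBr scaler_sumr addrACA -opprD -big_split /=; congr (_ - _).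
  by apply: eq_bigr => k _; rewrite scalerDl scalerA.
apply: le_lt_trans (nmD _ _ _) _; rewrite nmZ [ltRHS]splitr; apply: ler_ltD => //.
apply: le_trans (_ : (ab a + 1) * (d / 2 / (ab a + 1)) <= _); last first.
  by rewrite mulrC divfK // gt_eqF.
apply: ler_pM; rewrite ?ab_ge0 ?nm_ge0 ?lerDl //; exact: ltW.
Qed.

Lemma coord_basis m n : c (e m) n = (n == m)%:R.
Proof.
rewrite (@cuniq (e m) (fun n => (n == m)%:R)) // => d d0; exists m.+1 => N mN.
rewrite (bigD1 (Ordinal mN)) //= eqxx scale1r big1 => [|k].
  by rewrite addr0 subrr nm0.
by rewrite -val_eqE /= => /negbTE ->; rewrite scale0r.
Qed.

Lemma basis_neq0 n : e n <> 0.
Proof.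
move=> en0; have := coord_basis n n; have := coord_linear (-1) 0 0 n.
rewrite scaler0 addr0 mulN1r addNr => c0.
by rewrite en0 c0 eqxx => /esym/eqP; rewrite oner_eq0.
Qed.

Definition masks_le (k : R) (x : X) := forall N (m : pred nat),
  nm (\sum_(n < N | m n) c x n *: e n) <= k.

Hypothesis masks_bounded : forall x, exists k, masks_le k x.

Lemma masks_le_comb a x y k k' : masks_le k x -> masks_le k' y ->
  masks_le (ab a * k + k') (a *: x + y).
Proof.
move=> hx hy N m.
have -> : \sum_(n < N | m n) c (a *: x + y) n *: e n =
    a *: \sum_(n < N | m n) c x n *: e n + \sum_(n < N | m n) c y n *: e n.
  rewrite scaler_sumr -big_split /=; apply: eq_bigr => n _.
  by rewrite coord_linear scalerDl scalerA.
by apply: le_trans (nmD _ _ _) _; rewrite nmZ lerD // ler_wpM2l // ab_ge0.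
Qed.

Lemma masks_le0 : masks_le 0 0.
Proof.
move=> N m; rewrite big1 ?nm0 // => n _.
have := coord_linear (-1) 0 0 n; rewrite scaler0 addr0 mulN1r addNr => ->.
by rewrite scale0r.
Qed.

(** By Baire, elements with masks bounded by a fixed number are dense in a ball;
differences of such elements are dense in a ball around 0, and rescaling
follows. *)
Lemma masks_dense : exists2 C : R, 0 <= C & forall x (d : R), 0 < d ->
  exists z, masks_le (C * nm x) z /\ nm (x - z) < d.
Proof.
have cov x : exists k : nat, masks_le k%:R x.
  have [k kx] := masks_bounded x; exists (Num.truncn k).+1 => N m.
  by apply: le_trans (kx N m) _; exact/ltW/truncnS_gt.
have [k [x0 [r [r0 hr]]]] := baire_dense_ball S cov.
have near0 x d : 0 < d -> nm x < r ->
    exists z, masks_le (2 * k%:R) z /\ nm (x - z) < d.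
  move=> d0 xr; have d2 : 0 < d / 2 by rewrite divr_gt0.
  have [|z1 [k1 h1]] := hr (x0 + x) _ _ d2; first by rewrite opprD addNKr nmN.
  have [|z2 [k2 h2]] := hr x0 _ _ d2; first by rewrite subrr nm0.
  exists (z1 - z2); split.
    have := masks_le_comb (-1) k2 k1; rewrite abN ab1 scaleN1r [- z2 + z1]addrC.
    by have -> : 1 * k%:R + k%:R = 2 * k%:R :> R by ring.
  have -> : x - (z1 - z2) = (x0 + x - z1) - (x0 - z2).
    rewrite !opprB [x0 + x]addrC -!addrA; congr (_ + _).
    by rewrite [z2 - x0]addrC [- z1 + _]addrCA addNKr addrC.
  by apply: le_lt_trans (nmB _ _ _) _; rewrite [ltRHS]splitr ltrD.
exists (4 * k%:R / r); first by rewrite divr_ge0 ?mulr_ge0 // ltW.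
move=> x d d0; have [->|/eqP x0n] := eqVneq x 0.
  exists 0; rewrite subrr !nm0 mulr0; split=> //; exact: masks_le0.
have nx := nm_gt0 S x0n.
pose t := 2 * nm x / r.
have t0 : 0 < t by rewrite divr_gt0 ?mulr_gt0.
have [||z [kz hz]] := near0 (toK t^-1 *: x) (d / t).
- by rewrite divr_gt0.
- rewrite nmZ ab_toK gtr0_norm ?invr_gt0 // /t.
  have -> : (2 * nm x / r)^-1 * nm x = r / 2.
    by field; rewrite !gt_eqF.
  by rewrite ltr_pdivrMr // ltr_pMr // ltr1n.
exists (toK t *: z); split.
  have := masks_le_comb (toK t) kz masks_le0; rewrite !addr0 ab_toK gtr0_norm //.
  have -> // : t * (2 * k%:R) = 4 * k%:R / r * nm x by rewrite /t; ring.
have -> : x - toK t *: z = toK t *: (toK t^-1 *: x - z).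
  by rewrite scalerBr scalerA -rmorphM mulfV ?gt_eqF // rmorph1 scale1r.
by rewrite nmZ ab_toK gtr0_norm // mulrC -ltr_pdivlMr.
Qed.

(** As in the open mapping theorem, x = sum_j z_j where z_j has masks bounded by
a multiple of 2^(-j). The coordinates of the partial sums Y_j converge, and the
expansion with the limits b_n as coefficients converges to x because the masks
of b - c(Y_j) are of order 2^(-j); by uniqueness b = c x, which thus inherits
the bound. *)
Lemma masks_uniformly_bounded : exists C : R, forall x, masks_le (C * nm x) x.
Proof.
have [C C0 hC] := masks_dense; exists (2 * C) => x.
have [->|/eqP x0] := eqVneq x 0; first by rewrite nm0 mulr0; exact: masks_le0.
set L := nm x; have L0 : 0 < L by exact: nm_gt0.
pose g j : R := (2 ^+ j)^-1.
have g0 j : 0 < g j by rewrite invr_gt0 exprn_gt0.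
have gS j : g j.+1 = g j / 2 by rewrite /g exprS invfM mulrC.
have ex (q : nat * X) : exists z, masks_le (C * nm q.2) z /\ nm (q.2 - z) < L *
    g q.1.+1.
  by apply: hC; rewrite mulr_gt0.
have [z hz] := choice ex.
(* r j is the remainder x - Y_j. *)
pose r := fix r j := if j is i.+1 then r i - z (i, r i) else x.
have rle j : nm (r j) <= L * g j.
  case: j => [|j] /=; first by rewrite /g expr0 invr1 mulr1.
  by have [_ /ltW] := hz (j, r j).
have zle j : masks_le (C * (L * g j)) (z (j, r j)).
  have [h _] := hz (j, r j) => N m; apply: le_trans (h N m) _.
  by rewrite ler_wpM2l //; exact: rle.
pose Y j := x - r j.
have Ydiff j k : masks_le (2 * C * L * (g j - g (j + k)%N)) (Y (j + k)%N - Y j).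
  elim: k => [|k IH]; first by rewrite addn0 !subrr mulr0; exact: masks_le0.
  have := masks_le_comb 1 (zle (j + k)%N) IH.
  rewrite scale1r ab1 mul1r addnS gS.
  have -> : z ((j + k)%N, r (j + k)%N) + (Y (j + k)%N - Y j) = Y (j + k).+1 - Y j.
    have -> : Y (j + k).+1 = z ((j + k)%N, r (j + k)%N) + Y (j + k)%N.
      by rewrite /Y /= opprB addrCA.
    by rewrite addrA.
  have -> // : C * (L * g (j + k)%N) + 2 * C * L * (g j - g (j + k)%N) =
    2 * C * L * (g j - g (j + k)%N / 2) by field.
have Ymask j i : (j <= i)%N -> masks_le (2 * C * L * g j) (Y i - Y j).
  move=> /subnKC <- N m; apply: le_trans (Ydiff j (i - j)%N N m) _.
  by apply: ler_wpM2l; [rewrite !mulr_ge0 // ltW|rewrite gerBl ltW].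
have cB a b n : c (a - b) n = c a n - c b n.
  by have := coord_linear (-1) b a n; rewrite scaleN1r addrC => ->; ring.
have cb n : exists l, forall d, 0 < d ->
    exists N, forall i, (N <= i)%N -> ab (c (Y i) n - l) <= d.
  apply: scalar_complete => d d0.
  have en := nm_gt0 S (@basis_neq0 n).
  have [N hN] := geo_small (2 * C * L) (mulr_gt0 d0 en).
  exists N => i Ni; rewrite -cB -(ler_pM2r en) -nmZ; apply: le_trans (ltW hN).
  have := Ymask _ _ Ni n.+1 (pred1 n).
  rewrite big_mkcond big_ord_recr /= eqxx big1 ?add0r // => q _.
  by rewrite ltn_eqF.
have [b hb] := choice cb.
have lim_mask j N (m : pred nat) :
    nm (\sum_(n < N | m n) (b n - c (Y j) n) *: e n) <= 2 * C * L * g j.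
  apply/ler_addgt0Pr => d d0.
  pose s := 1 + \sum_(n < N) nm (e n).
  have s0 : 0 < s by rewrite ltr_pwDl // sumr_ge0 // => n _; exact: nm_ge0.
  have ds : 0 < d / s by rewrite divr_gt0.
  have [I hI] : exists I, forall n : 'I_N, forall i, (I <= i)%N -> ab (c (Y i)
      n - b n) <= d / s.
    have [F hF] := choice (fun n => hb n _ ds).
    exists (\max_(n < N) F n) => n i Fi; apply: hF; apply: leq_trans Fi.
    exact: (leq_bigmax (F := fun n : 'I_N => F n)).
  pose i := maxn I j.
  have -> : \sum_(n < N | m n) (b n - c (Y j) n) *: e n =
      \sum_(n < N | m n) c (Y i - Y j) n *: e n -
      \sum_(n < N | m n) (c (Y i) n - b n) *: e n.
    rewrite -sumrB; apply: eq_bigr => n _; rewrite -scalerBl (cB (Y i) (Y j));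
        congr (_ *: _); ring.
  apply: le_trans (nmB _ _ _) _; apply: lerD; first by apply: Ymask; exact: leq_maxr.
  apply: le_trans (nm_sum _ _ _ _) _.
  apply: (@le_trans _ _ (\sum_(n < N) d / s * nm (e n))).
    rewrite big_mkcond; apply: ler_sum => n _; case: ifP => _.
      by rewrite nmZ ler_wpM2r ?nm_ge0 // hI // leq_maxl.
    by rewrite mulr_ge0 ?nm_ge0 // ltW.
  rewrite -mulr_sumr -mulrA; apply: ler_piMr; first exact: ltW.
  by rewrite ler_pdivrMl // mulr1 /s lerDr.
have Y0 : Y 0%N = 0 by rewrite /Y subrr.
have c00 n : c 0 n = 0 by have := cB 0 0 n; rewrite subrr => ->; rewrite subrr.
have cE : c x = b.
  apply: cuniq => d d0; have d3 : 0 < d / 3 by rewrite divr_gt0.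
  have [J hJ] := geo_small (2 * C * L + L) d3.
  have [N0 hN0] := ccvg (Y J) d3.
  exists N0 => N /hN0 hN.
  have -> : \sum_(n < N) b n *: e n - x =
      \sum_(n < N) (b n - c (Y J) n) *: e n +
      (\sum_(n < N) c (Y J) n *: e n - Y J) - r J.
    have -> : \sum_(n < N) (b n - c (Y J) n) *: e n =
        \sum_(n < N) b n *: e n - \sum_(n < N) c (Y J) n *: e n.
      by rewrite -sumrB; apply: eq_bigr => n _; rewrite scalerBl.
    by rewrite addrA subrK /Y opprB -addrA; congr (_ + _); rewrite addrAC subrr sub0r.
  apply: le_lt_trans (nmB _ _ _) _.
  apply: le_lt_trans (lerD (nmD _ _ _) (rle J)) _.
  have := lim_mask J N predT; rewrite /g in rle *; move: hJ hN.
  by rewrite mulrDl; lra.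
move=> N m; rewrite cE.
have := lim_mask 0%N N m; rewrite Y0 /g expr0 invr1 mulr1.
by under eq_bigr => n _ do rewrite c00 subr0.
Qed.

End SchauderBasis.

Section UnconditionalBasis.
Variables (R : realType) (K : numFieldType) (S : scalars R K).
Variable X : completeNormedModType K.
Local Notation toK := (toK S).
Local Notation ab := (ab S).
Local Notation nm := (nm S).

Theorem unconditional_basis_system (e : nat -> X) : unconditional_basis e ->
  exists (e' : nat -> X) (f : nat -> X -> K) (U : R),
    unconditional_system S e' f U.
Proof.
move=> [basis unc].
have seriesE (b : nat -> K) N :
    series (fun n => b n *: e n) N = \sum_(n < N) b n *: e n.
  by rewrite /series /= big_mkord.
have cvgE (b : nat -> K) x : series (fun n => b n *: e n) @ \oo --> x <->
    forall d : R, 0 < d -> exists N0, forall N, (N0 <= N)%N ->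
      nm (\sum_(n < N) b n *: e n - x) < d.
  rewrite (cvg_nm S).
  by split=> h d /h[N0 hN0]; exists N0 => N /hN0; rewrite seriesE.
have [c hc] := choice basis.
have ccvg x (d : R) : 0 < d -> exists N0, forall N, (N0 <= N)%N ->
    nm (\sum_(n < N) c x n *: e n - x) < d.
  by move: d; apply/cvgE; have [] := hc x.
have cuniq x (b : nat -> K) : (forall d : R, 0 < d -> exists N0, forall N,
    (N0 <= N)%N -> nm (\sum_(n < N) b n *: e n - x) < d) -> c x = b.
  by move=> /cvgE; have [_] := hc x; apply.
have masks x : exists k : R, masks_le S e c k x.
  apply: (unconditional_masks_bounded S (v := fun n => c x n *: e n)).
  by apply: unc; apply/cvg_ex; exists x; have [] := hc x.
have [C hC] := masks_uniformly_bounded ccvg cuniq masks.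
have e0 n : 0 < nm (e n) by apply: nm_gt0; exact: (basis_neq0 ccvg cuniq).
pose e' n := toK (nm (e n))^-1 *: e n.
pose f n x := c x n * toK (nm (e n)).
have fe' n x : f n x *: e' n = c x n *: e n.
  by rewrite /f /e' scalerA -mulrA -rmorphM mulfV ?gt_eqF // rmorph1 mulr1.
exists e', f, (4 * C); split.
- by move=> n a x y; rewrite /f (coord_linear ccvg cuniq); ring.
- move=> n m; have := coord_linear ccvg cuniq (toK (nm (e m))^-1) (e m) 0 n.
  have c0 : c 0 n = 0.
    have := coord_linear ccvg cuniq (-1) 0 0 n.
    by rewrite scaler0 addr0 mulN1r addNr.
  rewrite c0 !addr0 (coord_basis cuniq) /f => ->.
  case: eqP => [->|_]; last by rewrite mulr0 mul0r.
  by rewrite mulr1 -rmorphM mulVf ?gt_eqF // rmorph1.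
- by move=> n; rewrite nmZ ab_toK gtr0_norm ?invr_gt0 // mulVf // gt_eqF.
- move=> th N x th1; rewrite -mulrA.
  have -> : \sum_(n < N) (th n * f n x) *: e' n = \sum_(n < N) th n *: (c x n *: e n).
    by apply: eq_bigr => n _; rewrite -scalerA fe'.
  exact: (masks_multipliers (v := fun n => c x n *: e n) (hC x N) th1).
- move=> x d /(ccvg x)[N0 hN0]; exists N0 => N /hN0.
  by under [in X in _ -> X]eq_bigr => n _ do rewrite fe'.
Qed.

End UnconditionalBasis.

(** * Forms on spaces on which every form is extendible *)

Section ExtendibleForms.
Variables (R : realType) (K : numFieldType) (S : scalars R K).
Variable X : normedModType K.
Local Notation toK := (toK S).
Local Notation ab := (ab S).
Local Notation nm := (nm S).

Definition dual_ball := {g : X -> K |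
  (forall a x y, g (a *: x + y) = a * g x + g y) /\ forall x, ab (g x) <= nm x}.

Lemma ev_bounded (x : X) :
  ((fun g : dual_ball => sval g x) : dual_ball -> K^o) \in
    @bounded_family _ _ S dual_ball.
Proof. by apply/asboolP; exists (nm x) => -[g [gl gx]] /=. Qed.

(** The canonical embedding of X into the bounded functions on its dual ball,
isometric by Hahn-Banach. *)
Definition ev (x : X) : linf S dual_ball := Linf (ev_bounded x).

Lemma ev_linear : linear ev.
Proof.
by move=> a x y; apply/val_inj/funext => -[g [gl gx]]; exact: (gl a x y).
Qed.

Lemma nm_ev x : nm (ev x) = nm x.
Proof.
rewrite nm_linf; apply/le_anti/andP; split.
  by apply: linf_sup_le; [exact: nm_ge0|move=> -[g [gl gx]]; exact: gx].
have [g [gl gx <-]] := norming_functional S x.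
exact: (ab_le_linf_sup (ev x) (exist _ g (conj gl gx))).
Qed.

Lemma dual_linear (g : dual_ball) :
  [/\ sval g 0 = 0, {morph sval g : x y / x + y} &
      forall a x, sval g (a *: x) = a * sval g x].
Proof. by have [gl _] := svalP g; exact: linear_formE. Qed.

Lemma dual_sum (g : dual_ball) I (r : seq I) (P : pred I) (F : I -> X) :
  sval g (\sum_(i <- r | P i) F i) = \sum_(i <- r | P i) sval g (F i).
Proof. by have [g0 gD _] := dual_linear g; exact: big_morph. Qed.

Definition weakly_2summing (k : R) (t : seq (X * X)) := forall g : dual_ball,
  \sum_(p <- t) ab (sval g p.1) ^+ 2 <= k /\
  \sum_(p <- t) ab (sval g p.2) ^+ 2 <= k.

Hypothesis ext : forall T : {bilinear X -> X -> K^o},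
  continuous_bilinear T -> extendible T.

Lemma extendible_dominated c (T : X -> X -> K) : bform S c T ->
  exists B, forall t, weakly_2summing 1 t -> ab (pairing T t) <= B.
Proof.
move=> /bform_continuous[T' [cT' T'E]].
have evl := ev_linear.
pose i : {linear X -> linf S dual_ball} :=
  HB.pack ev (GRing.isLinear.Build _ _ _ _ ev evl).
have iso : isometric i by move=> x; rewrite !(nmE S) nm_ev.
have extT : extendible T' := ext cT'.
have [S' [cS' S'E]] := extT (linf S dual_ball) (linf S dual_ball) i i iso iso.
have [c' c'0 bS'] := continuous_bform S cS'.
have g0 : dual_ball.
  by exists (fun _ => 0); split=> *; rewrite ?mulr0 ?addr0 ?ab0 ?nm_ge0.
exists (1024 * c') => t t1.
have -> : pairing T t = \sum_(d < size t)
    S' (ev (tnth (in_tuple t) d).1) (ev (tnth (in_tuple t) d).2).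
  rewrite /pairing big_tnth; apply: eq_bigr => d _.
  by rewrite -T'E -S'E.
apply: (grothendieck_linf g0 c'0 bS' (x := fun d => ev (tnth (in_tuple t) d).1)
    (y := fun d => ev (tnth (in_tuple t) d).2)) => g.
  by have [+ _] := t1 g; rewrite big_tnth.
by have [_ +] := t1 g; rewrite big_tnth.
Qed.

(** [uniform_boundedness] for the weakly 2-summing families, then rescaling of
the form and of the vectors. *)
Lemma extendible_uniformly_dominated : exists2 C, 0 <= C &
  forall m k T t, 0 < m -> 0 < k -> bform S m T -> weakly_2summing k t ->
    ab (pairing T t) <= C * m * k.
Proof.
have [C hC] := uniform_boundedness extendible_dominated.
have C0 : 0 <= C.
  have b0 : bform S 1 (fun (x y : X) => 0 : K).
    exact: bform_le (bform0 S X X).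
  apply: le_trans (ab_ge0 _ _) (hC _ [::] b0 _).
  by move=> g; rewrite !big_nil.
exists C => // m k T t m0 k0 Tm tk.
pose q := (Num.sqrt k)^-1.
have q0 : 0 < q by rewrite invr_gt0 sqrtr_gt0.
have q2 : q ^+ 2 = k^-1 by rewrite exprVn sqr_sqrtr // ltW.
pose t' := [seq (toK q *: p.1, toK q *: p.2) | p <- t].
have wt' : weakly_2summing 1 t'.
  move=> g; have [h1 h2] := tk g; have [_ _ gZ] := dual_linear g.
  have sq z : ab (toK q * z) ^+ 2 = k^-1 * ab z ^+ 2.
    by rewrite abM ab_toK gtr0_norm // exprMn q2.
  rewrite !big_map /=; split.
    under eq_bigr do rewrite gZ sq.
    by rewrite -mulr_sumr ler_pdivrMl // mulr1.
  under eq_bigr do rewrite gZ sq.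
  by rewrite -mulr_sumr ler_pdivrMl // mulr1.
have := hC _ _ (bform_scale_to1 m0 Tm) wt'.
have [TZl TZr] := bform_scale Tm.
have -> : pairing (fun x y => toK m^-1 * T x y) t' =
    toK (m^-1 * k^-1) * pairing T t.
  rewrite /pairing big_map mulr_sumr; apply: eq_bigr => p _ /=.
  rewrite TZl TZr -q2 expr2 !rmorphM /=; ring.
rewrite abM ab_toK gtr0_norm ?mulr_gt0 ?invr_gt0 // -invfM ler_pdivrMl ?mulr_gt0 //.
by move=> h; apply: le_trans h _; rewrite mulrC mulrA.
Qed.

End ExtendibleForms.

(** * Bounds for the sums of the basis vectors *)

(** Sylvester's construction, with the orthogonality of the rows up to the factor
2^k expressed as a Parseval identity. Entries are indexed by natural numbers and
only those below 2^k matter. *)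
Lemma hadamard (R : realType) (k : nat) :
  exists h : nat -> nat -> R, (forall r r', h r r' ^+ 2 = 1) /\
    forall z : nat -> R,
      \sum_(r < 2 ^ k) (\sum_(r' < 2 ^ k) h r r' * z r') ^+ 2 =
      (2 ^ k)%:R * \sum_(r < 2 ^ k) z r ^+ 2.
Proof.
elim: k => [|k [h [h1 hz]]].
  exists (fun _ _ => 1); split=> [r r'|z]; first by rewrite expr1n.
  by rewrite expn0 !big_ord1 !mul1r.
rewrite expnS mul2n -addnn; set M := (2 ^ k)%N in hz *.
pose h' r r' := h (r %% M)%N (r' %% M)%N * (if (M <= r)%N && (M <= r')%N then
    -1 else 1).
exists h'; split=> [r r'|z].
  by rewrite exprMn h1 mul1r; case: ifP; rewrite ?sqrrN expr1n.
have row r : \sum_(r' < M + M) h' r r' * z r' =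
    \sum_(r' < M) h (r %% M)%N r' * z r' +
    (if (M <= r)%N then -1 else 1) * \sum_(r' < M) h (r %% M)%N r' * z (M + r')%N.
  rewrite big_split_ord /= mulr_sumr; congr (_ + _); apply: eq_bigr => r' _.
    by rewrite /h' (modn_small (ltn_ord r')) (leqNgt M r') ltn_ord andbF mulr1.
  by rewrite /h' modnDl (modn_small (ltn_ord r')) leq_addr andbT; case: ifP => _; ring.
rewrite [LHS]big_split_ord [in RHS]big_split_ord /=.
under eq_bigr => r _ do rewrite row modn_small // (leqNgt M r) ltn_ord /= mul1r.
under [X in _ + X]eq_bigr => r _ do
  rewrite row modnDl modn_small // leq_addr /= mulN1r.
rewrite -big_split /= natrD mulrDr !mulrDl.
rewrite -(hz z) -(hz (fun r => z (M + r)%N)) -!big_split /=.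
by apply: eq_bigr => r _; ring.
Qed.

Section Blocks.
Variables (R : realType) (a : nat -> R) (M : nat).
Hypothesis a0 : forall n, 0 <= a n.
Hypothesis M0 : (0 < M)%N.

(** In a decreasing family, the squares of the entries of a block are at most
those of the least entry c' of the block before, which in turn is controlled by
the sum over that block; only the first block is bounded by means of c. *)
Lemma sorted_blocks (s : seq nat) (c : R) :
  pairwise (fun m n => a n <= a m) s -> {in s, forall n, a n <= c} ->
  exists (Bs : seq (seq nat)) (rest : seq nat),
    [/\ s = flatten Bs ++ rest, all (fun b => size b == M) Bs &
      \sum_(n <- s) a n ^+ 2 <=
      M%:R * c ^+ 2 + M%:R^-1 * \sum_(b <- Bs) (\sum_(n <- b) a n) ^+ 2].
Proof.
have M0R : 0 < M%:R :> R by rewrite ltr0n.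
have sum_le (t : seq nat) (d : R) : 0 <= d -> {in t, forall n, a n <= d} ->
    \sum_(n <- t) a n ^+ 2 <= (size t)%:R * d ^+ 2.
  move=> d0 td; have -> : (size t)%:R * d ^+ 2 = \sum_(n <- t) d ^+ 2.
    by rewrite big_const_seq count_predT iter_addr addr0 mulr_natl.
  rewrite !big_seq; apply: ler_sum => n nt.
  by rewrite lerXn2r ?nnegrE // td.
have [k] := ubnP (size s); elim: k => // k IH in s c *.
move=> sk ps sc; have [sM|Ms] := ltnP (size s) M.
  exists [::], s; split=> //; rewrite big_nil mulr0 addr0.
  case: s sc sM {sk ps} => [|n s] sc sM; first by rewrite big_nil mulr_ge0 ?sqr_ge0.
  have c0 : 0 <= c by apply: le_trans (a0 n) (sc n (mem_head _ _)).
  apply: le_trans (sum_le _ _ c0 sc) _.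
  by rewrite ler_wpM2r ?sqr_ge0 // ler_nat ltnW.
set b := take M s; set s' := drop M s.
have sE : s = b ++ s' by rewrite cat_take_drop.
have bM : size b = M by rewrite size_takel.
have : pairwise (fun m n => a n <= a m) (b ++ s') by rewrite -sE.
rewrite pairwise_cat => /and3P[bs' pb ps'].
have [c' c'0 [bc' s'c']] : exists2 c', 0 <= c' &
    {in b, forall n, c' <= a n} /\ {in s', forall n, a n <= c'}.
  case/lastP: b bM bs' pb {sE} => [|b l] bM bs' pb; first by move: M0; rewrite -bM.
  exists (a l) => //; split=> n.
    move: pb; rewrite pairwise_rcons => /andP[/allP pb _].
    by rewrite mem_rcons inE => /predU1P[->//|/pb].
  by move=> ns'; move/allrelP: bs'; apply; rewrite // mem_rcons mem_head.
have s'k : (size s' < k)%N.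
  by rewrite size_drop -ltnS (leq_trans _ sk) // ltnS ltn_subrL M0 (leq_trans M0 Ms).
have [Bs [rest [s'E Bs_size IHs]]] := IH _ _ s'k ps' s'c'.
exists (b :: Bs), rest; split; first by rewrite /= -catA -s'E.
  by rewrite /= bM eqxx.
rewrite {1}sE big_cat big_cons /= mulrDr addrA.
have c0 : 0 <= c.
  case: b bM sE {bs' pb bc'} => [bM|n b _ sE]; first by move: M0; rewrite -bM.
  by apply: le_trans (a0 n) (sc n _); rewrite sE mem_head.
apply: (@le_trans _ _ (M%:R * c ^+ 2 +
  (M%:R * c' ^+ 2 + M%:R^-1 * \sum_(b <- Bs) (\sum_(n <- b) a n) ^+ 2))).
  apply: lerD => //; rewrite -bM; apply: sum_le => // n nb.
  by apply: sc; rewrite sE mem_cat nb.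
rewrite addrA !lerD2r lerD2l.
have Sb : M%:R * c' <= \sum_(n <- b) a n.
  have -> : M%:R * c' = \sum_(n <- b) c'.
    by rewrite big_const_seq count_predT iter_addr addr0 bM mulr_natl.
  by rewrite !big_seq; apply: ler_sum => n /bc'.
rewrite -(ler_pM2l M0R) [leRHS]mulrA mulfV ?gt_eqF // mul1r mulrA -expr2 -exprMn.
by rewrite lerXn2r ?nnegrE ?mulr_ge0 // sumr_ge0.
Qed.

Lemma block_decomposition (N : nat) : (forall n, a n <= 1) ->
  exists Bs : seq (seq nat),
    [/\ uniq (flatten Bs), {subset flatten Bs <= iota 0 N},
      all (fun b => size b == M) Bs &
      \sum_(n < N) a n ^+ 2 <=
      M%:R + M%:R^-1 * \sum_(b <- Bs) (\sum_(n <- b) a n) ^+ 2].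
Proof.
move=> a1; pose r m n := a n <= a m.
have rtr : transitive r by move=> x y z yx xz; exact: le_trans xz yx.
have rto : total r by move=> x y; exact: le_total.
pose s := sort r (iota 0 N).
have ps : pairwise r s by rewrite -sorted_pairwise // sort_sorted.
have [Bs [rest [sE Bs_size h]]] := sorted_blocks ps (fun n _ => a1 n).
exists Bs; split=> //.
- have : uniq s by rewrite sort_uniq iota_uniq.
  by rewrite sE cat_uniq => /and3P[].
- by move=> n nB; rewrite -(mem_sort r) -/s sE mem_cat nB.
- move: h; rewrite expr1n mulr1 -(big_mkord xpredT (fun n => a n ^+ 2)).
  rewrite /index_iota subn0 (_ : \sum_(i <- iota 0 N) _ = \sum_(i <- s) a i ^+ 2) //.
  by apply: perm_big; rewrite perm_sym /s perm_sort.
Qed.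

End Blocks.


Definition block_of (Bs : seq (seq nat)) (n : nat) : seq nat :=
  nth [::] Bs (find (fun b : seq nat => n \in b) Bs).

(** The blocks are disjoint, so the first block containing n is the only one. *)
Lemma block_ofE (Bs : seq (seq nat)) b n :
  uniq (flatten Bs) -> b \in Bs -> n \in b -> block_of Bs n = b.
Proof.
rewrite /block_of; elim: Bs => //= b' Bs IH; rewrite cat_uniq => /and3P[_ dis uF].
rewrite inE => /predU1P[->|bBs] nb; first by rewrite nb.
case: ifPn => [nb'|_]; last exact: IH.
by case/hasP: dis; exists n => //; apply/flattenP; exists b.
Qed.

Section UnconditionalSystem.
Variables (R : realType) (K : numFieldType) (S : scalars R K).
Variable X : normedModType K.
Local Notation toK := (toK S).
Local Notation ab := (ab S).
Local Notation nm := (nm S).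

Variables (e : nat -> X) (f : nat -> X -> K) (U : R).
Hypothesis us : unconditional_system S e f U.

Lemma us_ge0 : 0 <= U.
Proof.
have := us_mult us 0%N (e 0%N) (th := fun _ => 0); rewrite big_ord0 nm0
    (us_norm1 us) mulr1.
by apply=> n; rewrite ab0.
Qed.

Lemma us_coord n x : ab (f n x) <= U * nm x.
Proof.
have := us_mult us n.+1 x (th := fun k => (k == n)%:R).
rewrite big_ord_recr /= eqxx mul1r big1 ?add0r => [|k _].
  by rewrite nmZ (us_norm1 us) mulr1; apply=> k; case: (_ == _); rewrite ?ab0 ?ab1.
by rewrite ltn_eqF // mul0r scale0r.
Qed.

(** The left-hand side is the value of g at the expansion of x after the
coordinates have been rotated so as to make all terms nonnegative. *)
Lemma us_dual (g : dual_ball S X) N x :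
  \sum_(n < N) ab (sval g (e n)) * ab (f n x) <= U * nm x.
Proof.
have [_ gb] := svalP g; have [_ _ gZ] := dual_linear g.
pose z n := f n x * sval g (e n).
pose th n := if z n == 0 then 0 else toK (ab (z n)) / z n.
have th1 n : ab (th n) <= 1.
  rewrite /th; case: eqP => [_|zn]; first by rewrite ab0.
  by rewrite abM abV ab_toK ger0_norm ?ab_ge0 // mulfV // gt_eqF // ab_gt0.
have thz n : th n * z n = toK (ab (z n)).
  by rewrite /th; case: eqP => [->|/eqP zn]; rewrite ?mul0r ?ab0 ?rmorph0 // divfK.
apply: le_trans (us_mult us N x th1); apply: le_trans (gb _).
rewrite dual_sum.
rewrite (eq_bigr (fun n : 'I_N => toK (ab (z n)))); last first.
  by move=> n _; rewrite gZ -mulrA -/(z n) thz.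
rewrite -rmorph_sum ab_toK; apply: le_trans (ler_norm _).
by apply: ler_sum => n _; rewrite /z abM mulrC.
Qed.

Definition coord_form N (tau : nat -> nat -> K) (x y : X) : K :=
  \sum_(n < N) \sum_(m < N) tau n m * (f n x * f m y).

Lemma coord_formE N tau n m : (n < N)%N -> (m < N)%N ->
  coord_form N tau (e n) (e m) = tau n m.
Proof.
move=> nN mN; rewrite /coord_form (bigD1 (Ordinal nN)) //= (bigD1 (Ordinal mN)) //=.
rewrite !(us_biorth us) !eqxx !mulr1 big1 => [|k kn]; last first.
  by rewrite (us_biorth us) (negbTE (kn : val k != m)) !mulr0.
rewrite addr0 big1 ?addr0 // => k kn; rewrite big1 // => l _.
by rewrite (us_biorth us) (negbTE (kn : val k != n)) mul0r mulr0.
Qed.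

Lemma coord_form_bform c N tau :
  (forall x y, ab (coord_form N tau x y) <= c * nm x * nm y) ->
  bform S c (coord_form N tau).
Proof.
move=> h; split=> // [a x x' y|a x y y'];
rewrite /coord_form mulr_sumr -big_split /=; apply: eq_bigr => n _;
rewrite mulr_sumr -big_split /=; apply: eq_bigr => m _;
rewrite (us_linear us); ring.
Qed.

Lemma ab_coord_form N tau x y : ab (coord_form N tau x y) <=
  \sum_(n < N) \sum_(m < N) ab (tau n m) * (ab (f n x) * ab (f m y)).
Proof.
apply: le_trans (ab_sum _ _ _ _) _; apply: ler_sum => n _.
apply: le_trans (ab_sum _ _ _ _) _; apply: ler_sum => m _.
by rewrite !abM.
Qed.

Lemma signed_form_bform (g : dual_ball S X) N (tau : nat -> nat -> K) :
  (forall n m, ab (tau n m) <= ab (sval g (e n)) * ab (sval g (e m))) ->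
  bform S (U * U) (coord_form N tau).
Proof.
move=> tau_le; apply: coord_form_bform => x y.
apply: le_trans (ab_coord_form _ _ _ _) _.
apply: (@le_trans _ _ ((\sum_(n < N) ab (sval g (e n)) * ab (f n x)) *
                       (\sum_(m < N) ab (sval g (e m)) * ab (f m y)))).
  rewrite mulr_suml; apply: ler_sum => n _; rewrite mulr_sumr.
  apply: ler_sum => m _; rewrite mulrACA ler_wpM2r //.
  by rewrite mulr_ge0 // ab_ge0.
have -> : U * U * nm x * nm y = (U * nm x) * (U * nm y) by ring.
by apply: ler_pM; rewrite ?us_dual // sumr_ge0 // => n _; rewrite mulr_ge0 ?ab_ge0.
Qed.

Lemma diagonal_form_bform (g : dual_ball S X) N :
  bform S (U * U) (coord_form N (fun n m => if n == m then sval g (e n) else 0)).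
Proof.
apply: coord_form_bform => x y.
apply: le_trans (ab_coord_form _ _ _ _) _.
apply: (@le_trans _ _ ((\sum_(n < N) ab (sval g (e n)) * ab (f n x)) * (U * nm y))).
  rewrite mulr_suml; apply: ler_sum => n _.
  rewrite (bigD1 n) //= eqxx big1 ?addr0 => [|m /negbTE].
    rewrite mulrA ler_wpM2l ?us_coord // mulr_ge0 ?ab_ge0 //.
  by rewrite -val_eqE eq_sym /= => ->; rewrite ab0 mul0r.
have -> : U * U * nm x * nm y = (U * nm x) * (U * nm y) by ring.
by rewrite ler_wpM2r ?us_dual // mulr_ge0 ?us_ge0 ?nm_ge0.
Qed.

End UnconditionalSystem.

Section UnitSums.
Variables (R : realType) (K : numFieldType) (S : scalars R K).
Variable X : normedModType K.
Local Notation toK := (toK S).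
Local Notation ab := (ab S).
Local Notation nm := (nm S).
Variables (e : nat -> X) (f : nat -> X -> K) (U : R).
Hypothesis us : unconditional_system S e f U.
Hypothesis ext : forall T : {bilinear X -> X -> K^o},
  continuous_bilinear T -> extendible T.

Lemma hadamard_ab k (h : nat -> nat -> R) (z : nat -> K) :
  (forall z : nat -> R,
     \sum_(r < 2 ^ k) (\sum_(r' < 2 ^ k) h r r' * z r') ^+ 2 =
     (2 ^ k)%:R * \sum_(r < 2 ^ k) z r ^+ 2) ->
  \sum_(r < 2 ^ k) ab (\sum_(r' < 2 ^ k) toK (h r r') * z r') ^+ 2 =
  (2 ^ k)%:R * \sum_(r < 2 ^ k) ab (z r) ^+ 2.
Proof.
move=> hz; under [LHS]eq_bigr do rewrite sqr_ab re_sum im_sum.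
rewrite big_split /=.
under eq_bigr => r _ do under eq_bigr => r' _ do rewrite reZ.
under [X in _ + X]eq_bigr => r _ do under eq_bigr => r' _ do rewrite imZ.
rewrite (hz (fun r => re S (z r))) (hz (fun r => im S (z r))) -mulrDr -big_split /=.
by congr (_ * _); apply: eq_bigr => r _; rewrite sqr_ab.
Qed.

Lemma sub_iota_sum (s : seq nat) N (F : nat -> R) :
  (forall n, 0 <= F n) -> uniq s -> {subset s <= iota 0 N} ->
  \sum_(n <- s) F n <= \sum_(n < N) F n.
Proof.
move=> F0 us' sN; rewrite -(big_mkord xpredT F) /index_iota subn0.
rewrite [leRHS](bigID (mem s)) /= -[leRHS]/(_ + _).
rewrite -[\sum_(i <- iota 0 N | i \in s) F i]big_filter.
have -> : \sum_(i <- [seq i <- iota 0 N | i \in s]) F i = \sum_(n <- s) F n.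
  apply: perm_big; apply: uniq_perm => //; first by rewrite filter_uniq // iota_uniq.
  by move=> n; rewrite mem_filter andb_idr // => /sN.
by rewrite lerDl sumr_ge0.
Qed.

(** The form tau, equal to a_n a_m h_nm within each block and 0 outside, is
bounded by U * U. It is paired with the family of the (e_n, y_n), where y_n is
2^(-k) times the combination of the vectors of the block of n with coefficients
in the row of n of the Hadamard matrix: this family is as weakly summing as the
e_n, by the Parseval identity. The pairing is 2^(-k) Q, as h_nm^2 = 1. *)
Lemma hadamard_test (C kap : R) (k N : nat) (g : dual_ball S X) :
  (forall (m k : R) (T : X -> X -> K) (t : seq (X * X)), 0 < m -> 0 < k ->
      bform S m T -> weakly_2summing S k t ->
    ab (pairing T t) <= C * m * k) -> 0 < U -> 0 < kap ->
  (forall g : dual_ball S X, \sum_(n < N) ab (sval g (e n)) ^+ 2 <= kap) ->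
  \sum_(n < N) ab (sval g (e n)) ^+ 2 <=
    (2 ^ k * 2 ^ k)%:R + (2 ^ k)%:R^-1 * (C * (U * U) * kap).
Proof.
move=> hC U0 kap0 hkap.
have [h [h1 hz]] := hadamard R (k + k).
rewrite -expnD; set M := (2 ^ (k + k))%N in hz *.
pose a n := ab (sval g (e n)).
have M0 : (0 < M)%N by rewrite expn_gt0.
have M0R : 0 < M%:R :> R by rewrite ltr0n.
have sM0 : 0 < (2 ^ k)%:R :> R by rewrite ltr0n expn_gt0.
have sM2 : (2 ^ k)%:R * (2 ^ k)%:R = M%:R :> R by rewrite -natrM -expnD.
have a1 n : a n <= 1.
  by have [_ gb] := svalP g; apply: le_trans (gb _) _; rewrite (us_norm1 us).
have a0 n : 0 <= a n by exact: ab_ge0.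
have [Bs [uBs sBs /allP szBs decomp]] := block_decomposition a0 M0 N a1.
apply: le_trans decomp _; rewrite lerD2l.
set Q := \sum_(b <- Bs) _.
suff : (2 ^ k)%:R^-1 * Q <= C * (U * U) * kap.
  have -> : M%:R^-1 * Q = (2 ^ k)%:R^-1 * ((2 ^ k)%:R^-1 * Q).
    by rewrite -sM2 invfM mulrA.
  by move=> ?; rewrite ler_pM2l ?invr_gt0.
pose tau n m : K := if m \in block_of Bs n then
  toK (a n * a m * h (index n (block_of Bs n)) (index m (block_of Bs n))) else 0.
have tau_le n m : ab (tau n m) <= a n * a m.
  rewrite /tau; case: ifP => _; last by rewrite ab0 mulr_ge0.
  rewrite ab_toK !normrM (ger0_norm (a0 n)) (ger0_norm (a0 m)).
  have : `|h (index n (block_of Bs n)) (index m (block_of Bs n))| ^+ 2 = 1.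
    by rewrite real_normK ?num_real.
  move=> /eqP; rewrite sqrp_eq1 // => /eqP ->.
  by rewrite mulr1.
pose T := coord_form f N tau.
have Tb : bform S (U * U) T by apply: (signed_form_bform us (g := g)); exact: tau_le.
pose y (b : seq nat) r : X := toK (2 ^ k)%:R^-1 *:
  \sum_(r' < M) toK (h r r') *: e (nth 0%N b r').
pose t := [seq (e (nth 0%N b r), y b r) | b <- Bs, r <- iota 0 M].
have sum_t (V : nmodType) (G : X * X -> V) : \sum_(p <- t) G p =
    \sum_(b <- Bs) \sum_(r < M) G (e (nth 0%N b r), y b r).
  rewrite /t big_allpairs_dep; apply: eq_bigr => b _.
  by rewrite -(big_mkord xpredT (fun r => G (e (nth 0%N b r), y b r)))
      /index_iota subn0.
have sum_b (F : nat -> R) b : b \in Bs ->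
    \sum_(r < M) F (nth 0%N b r) = \sum_(n <- b) F n.
  by move=> /szBs/eqP bM; rewrite (big_nth 0%N) bM big_mkord.
have wt : weakly_2summing S kap t.
  move=> g'; have [_ _ gZ] := dual_linear g'.
  have base : \sum_(b <- Bs) \sum_(r < M) ab (sval g' (e (nth 0%N b r))) ^+ 2 <= kap.
    apply: le_trans (hkap g'); rewrite big_seq.
    rewrite (eq_bigr _ (fun b bB => sum_b (fun n => ab (sval g' (e n)) ^+ 2) b bB)).
    rewrite -big_seq -(big_flatten _ _ _ (fun n => ab (sval g' (e n)) ^+ 2)).
    by apply: sub_iota_sum => // n; exact: sqr_ge0.
  rewrite !sum_t /=; split=> //; apply: le_trans base.
  rewrite le_eqVlt; apply/orP; left; apply/eqP; apply: eq_bigr => b _.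
  have step r : ab (sval g' (y b r)) ^+ 2 = M%:R^-1 *
      ab (\sum_(r' < M) toK (h r r') * sval g' (e (nth 0%N b r'))) ^+ 2.
    rewrite /y gZ dual_sum abM ab_toK gtr0_norm ?invr_gt0 // exprMn exprVn expr2 sM2.
    by congr (_ * ab _ ^+ 2); apply: eq_bigr => r' _; rewrite gZ.
  under eq_bigr do rewrite step.
  rewrite -mulr_sumr (hadamard_ab (fun r => sval g' (e (nth 0%N b r))) hz).
  by rewrite mulKf // gt_eqF.
have := hC _ _ _ _ (mulr_gt0 U0 U0) kap0 Tb wt.
have -> : pairing T t = toK ((2 ^ k)%:R^-1 * Q).
  rewrite /pairing sum_t /= /Q mulr_sumr rmorph_sum /= !big_seq.
  apply: eq_bigr => b bB; have /eqP bM := szBs b bB.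
  have [TZl TZr] := bform_scale Tb; have [TsumL TsumR] := bform_sum Tb.
  have ub : uniq b.
    have : subseq b (flatten Bs).
      elim: (Bs) bB {uBs sBs szBs} => //= c l IH; rewrite inE => /predU1P[->|/IH].
        exact: prefix_subseq.
      by move=> /subseq_trans; apply; exact: suffix_subseq.
    by move=> /subseq_uniq; apply.
  have TE (r r' : 'I_M) : T (e (nth 0%N b r)) (e (nth 0%N b r')) =
      toK (a (nth 0%N b r) * a (nth 0%N b r') * h r r').
    have inb (q : 'I_M) : nth 0%N b q \in b by rewrite mem_nth // bM.
    have ltN (q : 'I_M) : (nth 0%N b q < N)%N.
      have : nth 0%N b q \in iota 0 N by apply: sBs; apply/flattenP; exists b.
      by rewrite mem_iota add0n.
    rewrite /T (coord_formE us) // /tau (block_ofE uBs bB (inb r)) inb.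
    by rewrite !index_uniq // bM.
  rewrite (eq_bigr (fun r : 'I_M => \sum_(r' < M)
      toK ((2 ^ k)%:R^-1 * (a (nth 0%N b r) * a (nth 0%N b r'))))); last first.
    move=> r _; rewrite /y TZr TsumR mulr_sumr; apply: eq_bigr => r' _.
    rewrite TZr TE -!rmorphM; congr (GRing.RMorphism.sort _ _).
    by rewrite -[RHS]mulr1 -(h1 r r'); ring.
  under eq_bigr do rewrite -rmorph_sum.
  rewrite -rmorph_sum; congr (GRing.RMorphism.sort _ _).
  rewrite -(sum_b a) // expr2 mulr_suml mulr_sumr; apply: eq_bigr => r _.
  by rewrite !mulr_sumr.
rewrite ab_toK; apply: le_trans; exact: ler_norm.
Qed.

(** k is chosen such that the term proportional to kap on the right of
[hadamard_test] is at most kap / 4, while the left-hand side exceeds kap / 2 for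
suitable g. *)
Lemma weak_l2_bound : exists2 kap, 0 < kap &
  forall N (g : dual_ball S X), \sum_(n < N) ab (sval g (e n)) ^+ 2 <= kap.
Proof.
have [C C0 hC] := extendible_uniformly_dominated S ext.
have U0 : 0 < U.
  apply: lt_le_trans ltr01 _; have := us_coord us 0%N (e 0%N).
  by rewrite (us_biorth us) eqxx ab1 (us_norm1 us) mulr1.
pose k := (Num.truncn (4 * C * (U * U))).+1.
exists (4 * (2 ^ k * 2 ^ k)%:R) => [|N g].
  by rewrite mulr_gt0 // ltr0n muln_gt0 expn_gt0.
pose A := [set \sum_(n < N) ab (sval g (e n)) ^+ 2 | g in [set: dual_ball S X]].
have supA : has_sup A.
  split; first by exists (\sum_(n < N) ab (sval g (e n)) ^+ 2), g.
  exists N%:R => _ [g' _ <-].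
  have -> : N%:R = \sum_(n < N) 1 :> R by rewrite sumr_const card_ord.
  apply: ler_sum => n _; rewrite exprn_ile1 ?ab_ge0 //.
  by have [_ gb] := svalP g'; apply: le_trans (gb _) _; rewrite (us_norm1 us).
have hA (g' : dual_ball S X) : \sum_(n < N) ab (sval g' (e n)) ^+ 2 <= sup A.
  by apply: ub_le_sup; [case: supA|exists g'].
apply: le_trans (hA g) _.
have [kap0|kap0] := leP (sup A) 0; first by apply: le_trans kap0 _; rewrite mulr_ge0.
have s2 : 0 < sup A / 2 by rewrite divr_gt0.
have [_ [g' _ <-] hg'] := sup_adherent s2 supA.
have := hadamard_test k g' hC U0 kap0 hA.
have k0 : 0 < (2 ^ k)%:R :> R by rewrite ltr0n expn_gt0.
have hk : (2 ^ k)%:R^-1 * (C * (U * U) * sup A) <= sup A / 4.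
  rewrite ler_pdivrMl //.
  have : 4 * C * (U * U) <= (2 ^ k)%:R.
    apply: ltW; apply: lt_trans (truncnS_gt _) _.
    by rewrite ltr_nat ltn_expl.
  move=> /(ler_wpM2r (ltW kap0)); lra.
by lra.
Qed.

(** The form sum_n g(e_n) f_n(x) f_n(y), where g norms the sum of the e_n, paired
with the family of the (e_n, e_n). *)
Theorem unit_sums_bounded : exists B : R, forall N, nm (\sum_(n < N) e n) <= B.
Proof.
have [C C0 hC] := extendible_uniformly_dominated S ext.
have [kap kap0 hkap] := weak_l2_bound.
have U0 : 0 < U.
  apply: lt_le_trans ltr01 _; have := us_coord us 0%N (e 0%N).
  by rewrite (us_biorth us) eqxx ab1 (us_norm1 us) mulr1.
exists (C * (U * U) * kap) => N.
have [g0 [gl gb gN]] := norming_functional S (\sum_(n < N) e n).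
pose g : dual_ball S X := exist _ g0 (conj gl gb).
pose T := coord_form f N (fun n m => if n == m then sval g (e n) else 0).
have Tb : bform S (U * U) T by exact: diagonal_form_bform us g N.
pose t := [seq (e n, e n) | n <- iota 0 N].
have sum_t (V : nmodType) (G : X * X -> V) : \sum_(p <- t) G p = \sum_(n < N) G
    (e n, e n).
  by rewrite big_map -(big_mkord xpredT (fun n => G (e n, e n))) /index_iota subn0.
have wt : weakly_2summing S kap t.
  by move=> g'; rewrite !sum_t /=; split; exact: hkap.
have := hC _ _ _ _ (mulr_gt0 U0 U0) kap0 Tb wt.
have -> : pairing T t = sval g (\sum_(n < N) e n).
  rewrite dual_sum /pairing sum_t; apply: eq_bigr => n _ /=.
  by rewrite /T (coord_formE us) // eqxx.
by rewrite /= gN.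
Qed.

End UnitSums.

(** * The space c_0 *)

Section IsomorphicC0.
Variables (R : realType) (K : numFieldType) (S : scalars R K).
Variable X : completeNormedModType K.
Local Notation toK := (toK S).
Local Notation ab := (ab S).
Local Notation nm := (nm S).

Lemma nm_c0_max (u : c0 K) : exists m, nm u = ab (u m).
Proof.
have [m [um _]] := c0_norm_max u; exists m.
by apply: (@toK_inj _ _ S); rewrite -nmE -normK -um.
Qed.

Lemma ab_le_nm_c0 (u : c0 K) n : ab (u n) <= nm u.
Proof. by rewrite -(toK_le S) -nmE -normK; exact: ler_c0_norm. Qed.

Lemma c0_null (u : c0 K) (d : R) : 0 < d ->
  exists N, forall n, (N <= n)%N -> ab (u n) < d.
Proof.
move=> d0; have /asboolP/(cvg_nm S)/(_ d d0)[N uN] : c0_seq u \in @null_seq K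
    by case: u.
by exists N => n /uN; rewrite subr0 nm_ab.
Qed.

Lemma null_c0 (u : nat -> K^o) :
  (forall d : R, 0 < d -> exists N, forall n, (N <= n)%N -> ab (u n) < d) ->
  u \in @null_seq K.
Proof.
move=> u0; apply/asboolP/(cvg_nm S) => d /u0[N uN].
by exists N => n /uN; rewrite subr0 nm_ab.
Qed.

Variables (e : nat -> X) (f : nat -> X -> K) (U B : R).
Hypothesis us : unconditional_system S e f U.
Hypothesis eB : forall N, nm (\sum_(n < N) e n) <= B.

Let U0 : 0 <= U := us_ge0 us.
Let B0 : 0 <= B.
Proof. exact: le_trans (nm_ge0 _ _) (eB 0). Qed.

Lemma coord_sum (c : nat -> K) N n :
  f n (\sum_(k < N) c k *: e k) = if (n < N)%N then c n else 0.
Proof.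
have [f0 fD fZ] := linear_formE (us_linear us n).
rewrite (big_morph (f n) fD f0).
under eq_bigr => k _ do rewrite fZ (us_biorth us).
case: ifP => nN.
  rewrite (bigD1 (Ordinal nN)) //= eqxx mulr1 big1 ?addr0 // => k.
  by rewrite -val_eqE eq_sym /= => /negbTE ->; rewrite mulr0.
rewrite big1 // => k _; case: eqP => [nk|_]; last by rewrite mulr0.
by have := ltn_ord k; rewrite -nk nN.
Qed.

(** The multiplier c_n / d, applied to the sum of the unit vectors. *)
Lemma tail_bound (c : nat -> K) m N (d : R) : 0 < d ->
  (forall n, (m <= n)%N -> ab (c n) <= d) ->
  nm (\sum_(n < N) (if (m <= n)%N then c n else 0) *: e n) <= U * B * d.
Proof.
move=> d0 cd.
pose th n := toK d^-1 * (if (m <= n)%N then c n else 0).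
have th1 n : ab (th n) <= 1.
  rewrite abM ab_toK gtr0_norm ?invr_gt0 // ler_pdivrMl // mulr1.
  by case: ifP => [/cd//|_]; rewrite ab0 ltW.
have fe n : (n < N)%N -> f n (\sum_(k < N) e k) = 1.
  move=> nN; have := coord_sum (fun _ => 1) N n; rewrite nN => <-.
  by congr (f n _); apply: eq_bigr => k _; rewrite scale1r.
have := us_mult us N (\sum_(k < N) e k) th1.
rewrite (eq_bigr (fun n : 'I_N => toK d^-1 *: ((if (m <= n)%N then c n else 0)
    *: e n)));
  last by move=> n _; rewrite fe // mulr1 scalerA.
rewrite -scaler_sumr nmZ ab_toK gtr0_norm ?invr_gt0 // ler_pdivrMl // => h.
apply: le_trans h _; rewrite mulrC.
by apply: ler_wpM2r; [exact: ltW|exact: ler_wpM2l].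
Qed.

Let psum (u : nat -> K) N := \sum_(n < N) u n *: e n.

Lemma c0_series_cvg (u : c0 K) : cvgn (psum u).
Proof.
apply: (cauchy_nm (S := S)) => d d0.
pose d' := d / (U * B + 1).
have UB : 0 < U * B + 1 by rewrite ltr_wpDl // mulr_ge0.
have d'0 : 0 < d' by rewrite divr_gt0.
have [N uN] := c0_null u d'0; exists N => n Nn.
have -> : psum u n - psum u N = \sum_(k < n) (if (N <= k)%N then c0_seq u k
    else 0) *: e k.
  rewrite /psum -(subnKC Nn) !big_split_ord /= addrAC addrC.
  have -> : \sum_(i < N) u i *: e i - \sum_(i < N) u i *: e i = 0 by rewrite subrr.
  rewrite addr0 [X in _ = X + _]big1 ?add0r => [|k _]; last first.
    by rewrite leqNgt ltn_ord scale0r.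
  by apply: eq_bigr => k _; rewrite leq_addr.
apply: le_lt_trans (tail_bound _ d'0 _) _; first by move=> k /uN/ltW.
by rewrite /d' mulrA ltr_pdivrMr // mulrC ltr_pM2l // ltrDl.
Qed.

Definition c0_sum (u : c0 K) : X := limn (psum u).

Lemma c0_sumP (u : c0 K) (d : R) : 0 < d ->
  exists N0, forall N, (N0 <= N)%N -> nm (psum u N - c0_sum u) < d.
Proof. by move: d; apply/(cvg_nm S); exact: c0_series_cvg. Qed.

Lemma coord_c0_sum (u : c0 K) n : f n (c0_sum u) = u n.
Proof.
apply/eqP; rewrite -subr_eq0; apply/eqP/(@ab_eq0 _ _ S)/le_anti.
rewrite ab_ge0 andbT; apply/ler_addgt0Pr => d d0; rewrite add0r.
have U1 : 0 < U + 1 by rewrite ltr_wpDl.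
have [|N0 hN] := c0_sumP u (d := d / (U + 1)); first by rewrite divr_gt0.
pose N := maxn N0 n.+1.
have nN : (n < N)%N by rewrite /N leq_max leqnn orbT.
have -> : f n (c0_sum u) - u n = f n (c0_sum u - psum u N).
  have := us_linear us n (-1) (psum u N) (c0_sum u).
  by rewrite scaleN1r addrC => ->; rewrite coord_sum nN mulN1r addrC.
apply: le_trans (us_coord us _ _) _; rewrite nm_distC.
have := hN N (leq_maxl _ _); rewrite ltr_pdivlMr // => h.
have := nm_ge0 S (psum u N - c0_sum u); nra.
Qed.

Lemma system_ext (x y : X) : (forall n, f n x = f n y) -> x = y.
Proof.
move=> fxy; apply/eqP; rewrite -subr_eq0; apply/eqP/(@nm_eq0 _ _ S)/le_anti.
rewrite nm_ge0 andbT; apply/ler_addgt0Pr => d d0; rewrite add0r.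
have d2 : 0 < d / 2 by rewrite divr_gt0.
have [N1 h1] := us_cvg us x d2; have [N2 h2] := us_cvg us y d2.
have := h1 _ (leq_maxl N1 N2); have := h2 _ (leq_maxr N1 N2).
under eq_bigr do rewrite -fxy.
move: (\sum_(n < _) _) => z yz xz.
apply: le_trans (nm_dist3 _ z _ _) _; rewrite [leRHS]splitr ltW //.
by rewrite ltrD // nm_distC.
Qed.

(** Taking coordinates and summing series are inverse to each other; the
coordinates tend to 0 since |f_n(x)| is the norm of a difference of consecutive
partial sums. *)
Theorem isomorphic_c0 : isomorphic X (c0 K).
Proof.
have coord_null x : ((fun n => f n x) : nat -> K^o) \in @null_seq K.
  apply: null_c0 => d d0.
  have [|N hN] := us_cvg us x (d := d / 2); first by rewrite divr_gt0.
  exists N => n Nn; have h1 := hN n Nn; have h2 := hN n.+1 (leqW Nn).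
  rewrite big_ord_recr /= in h2.
  have -> : ab (f n x) = nm (f n x *: e n) by rewrite nmZ (us_norm1 us) mulr1.
  move: h1 h2; set s := \sum_(k < n) _ => h1 h2.
  have -> : f n x *: e n = (s + f n x *: e n - x) - (s - x).
    by rewrite opprB addrA subrK addrC addKr.
  apply: le_lt_trans (nmB _ _ _) _.
  by rewrite [ltRHS]splitr ltrD.
pose G x : c0 K := C0 (coord_null x).
have Glin : linear G.
  by move=> a x y; apply/val_inj/funext => n; exact: (us_linear us).
have Flin : linear c0_sum.
  move=> a u v; apply: system_ext => n.
  by rewrite (us_linear us) !coord_c0_sum.
pose g : {linear X -> c0 K} := HB.pack G (GRing.isLinear.Build _ _ _ _ G Glin).
pose h : {linear c0 K -> X} :=
  HB.pack c0_sum (GRing.isLinear.Build _ _ _ _ c0_sum Flin).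
exists g, h; split.
- by move=> x; apply: system_ext => n; rewrite coord_c0_sum.
- by move=> u; apply/val_inj/funext => n; exact: coord_c0_sum.
- apply: (linear_bounded_continuous_nm (S := S) (c := U)) => x.
  have [m ->] := nm_c0_max (G x); exact: (us_coord us).
- apply: (linear_bounded_continuous_nm (S := S) (c := U * B)) => u.
  apply/ler_addgt0Pr => d d0.
  have [N hN] := c0_sumP u d0; have {}hN := hN N (leqnn N).
  have [->|/eqP u0] := eqVneq u 0.
    by rewrite linear0 !nm0 mulr0 add0r ltW.
  have -> : h u = psum u N - (psum u N - c0_sum u) by rewrite subKr.
  apply: le_trans (nmB _ _ _) _; apply: lerD; last exact: ltW.
  have := @tail_bound u 0 N (nm u) (nm_gt0 S u0) (fun n _ => ab_le_nm_c0 u n).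
  by [].
Qed.

End IsomorphicC0.

Section FormsOnC0.
Variables (R : realType) (K : numFieldType) (S : scalars R K).
Local Notation toK := (toK S).
Local Notation ab := (ab S).
Local Notation nm := (nm S).

Lemma truncation_null N (a : nat -> K) :
  ((fun k => if (k < N)%N then a k else 0) : nat -> K^o) \in @null_seq K.
Proof.
apply: (@null_c0 _ _ S) => d d0; exists N => n Nn.
by rewrite ltnNge Nn ab0.
Qed.

Definition truncation N (a : nat -> K) : c0 K := C0 (truncation_null N a).

Lemma truncation_linear N c a b :
  truncation N (fun n => c * a n + b n) = c *: truncation N a + truncation N b.
Proof.
apply/val_inj/funext => k.
have -> : val (c *: truncation N a + truncation N b) k =
  c * truncation N a k + truncation N b k by [].
by rewrite /=; case: ifP; rewrite ?mulr0 ?addr0.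
Qed.

Lemma nm_truncation_le N a (d : R) : 0 <= d -> (forall n, ab (a n) <= d) ->
  nm (truncation N a) <= d.
Proof.
move=> d0 ad; have [m ->] := nm_c0_max S (truncation N a).
by rewrite /=; case: ifP => // _; rewrite ab0.
Qed.

Lemma truncation_cvg (u : c0 K) (d : R) : 0 < d ->
  exists N, forall n, (N <= n)%N -> nm (truncation n u - u) <= d.
Proof.
move=> d0; have [N uN] := c0_null S u d0; exists N => n Nn.
have [m ->] := nm_c0_max S (truncation n u - u).
have -> : (truncation n u - u) m = truncation n u m - u m by [].
rewrite /=; case: ltnP => mn; first by rewrite subrr ab0 ltW.
by rewrite sub0r abN ltW // uN // (leq_trans Nn).
Qed.

Lemma extended_coordinates (X E : normedModType K) (i : {linear X -> E})
    (g : {linear X -> c0 K}) (c : R) : 0 <= c -> isometric i ->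
  (forall x, nm (g x) <= c * nm x) ->
  exists phi : nat -> E -> K, [/\
    forall n a z w, phi n (a *: z + w) = a * phi n z + phi n w,
    forall n z, ab (phi n z) <= c * nm z &
    forall n x, phi n (i x) = g x n].
Proof.
move=> c0 iso gc.
have ex n : exists p : E -> K, [/\ forall a z w, p (a *: z + w) = a * p z + p w,
    forall z, ab (p z) <= c * nm z & forall x, p (i x) = g x n].
  apply: (@hahn_banach _ _ _ _ _ i (fun x => g x n)) => // [a x y|x|a x y|x].
  - by rewrite linearP.
  - by rewrite /nm iso.
  - by rewrite linearP.
  - exact: le_trans (ab_le_nm_c0 S _ _) (gc x).
have [phi hphi] := choice ex.
by exists phi; split=> n; have [] := hphi n.
Qed.

(** P N z is bounded in N because truncating a bounded sequence does not increase
its supremum norm, and P N (i x) tends to x because the truncations of a null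
sequence converge to it in c_0. *)
Theorem isomorphic_c0_extendible (X : normedModType K) :
  isomorphic X (c0 K) ->
  forall T : {bilinear X -> X -> K^o}, continuous_bilinear T -> extendible T.
Proof.
move=> [g [h [gK _ cg ch]]] T /(continuous_bform S)[ct ct0 Tb] E F i j isoi isoj.
have [mg mg0 gb] := continuous_linear_bounded_nm S cg.
have [mh mh0 hb] := continuous_linear_bounded_nm S ch.
have [phi [phil phib phii]] := extended_coordinates mg0 isoi gb.
have [psi [psil psib psij]] := extended_coordinates mg0 isoj gb.
have [Tl Tr Tc] := Tb.
have [LIM [LIMl LIMc]] := generalized_limit S.
pose P N z := h (truncation N (phi^~ z)).
pose Q N w := h (truncation N (psi^~ w)).
have Pb N z : nm (P N z) <= mh * (mg * nm z).
  apply: le_trans (hb _) _; rewrite ler_wpM2l // nm_truncation_le //.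
  by rewrite mulr_ge0 ?nm_ge0.
have Qb N w : nm (Q N w) <= mh * (mg * nm w).
  apply: le_trans (hb _) _; rewrite ler_wpM2l // nm_truncation_le //.
  by rewrite mulr_ge0 ?nm_ge0.
have Pl N a z w : P N (a *: z + w) = a *: P N z + P N w.
  rewrite /P -linearP -truncation_linear; congr (h (truncation N _)).
  by apply/funext => n; rewrite phil.
have Ql N a z w : Q N (a *: z + w) = a *: Q N z + Q N w.
  rewrite /Q -linearP -truncation_linear; congr (h (truncation N _)).
  by apply/funext => n; rewrite psil.
have Tbd z w N : ab (T (P N z) (Q N w)) <= ct * (mh * mg) ^+ 2 * nm z * nm w.
  apply: le_trans (Tc _ _) _.
  have -> : ct * (mh * mg) ^+ 2 * nm z * nm w =
    ct * (mh * (mg * nm z)) * (mh * (mg * nm w)) by ring.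
  by apply: ler_pM; rewrite ?mulr_ge0 ?nm_ge0 // ler_wpM2l.
have bT z w : bounded_seq S (fun N => T (P N z) (Q N w)).
  by exists (ct * (mh * mg) ^+ 2 * nm z * nm w); exact: Tbd.
pose W z w := LIM (fun N => T (P N z) (Q N w)).
have Wb : bform S (ct * (mh * mg) ^+ 2) W.
  split=> [a z z' w|a z w w'|z w].
  - rewrite /W -LIMl //; congr LIM; apply/funext => N.
    by rewrite Pl Tl.
  - rewrite /W -LIMl //; congr LIM; apply/funext => N.
    by rewrite Ql Tr.
  - have := LIMc _ 0 (ct * (mh * mg) ^+ 2 * nm z * nm w) 0%N (bT z w).
    by rewrite subr0; apply=> N _; rewrite subr0; exact: Tbd.
have [W' [cW' W'E]] := bform_continuous Wb.
exists W'; split=> // x y; rewrite W'E.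
apply/eqP; rewrite -subr_eq0; apply/eqP/(@ab_eq0 _ _ S)/le_anti.
rewrite ab_ge0 andbT; apply/ler_addgt0Pr => d d0; rewrite add0r.
pose A := ct * (mh * mg * nm y + nm x + 1) * (mh + 1).
have A0 : 0 <= A.
  by rewrite !mulr_ge0 // !addr_ge0 // ?mulr_ge0 ?nm_ge0.
have dA : 0 < d / (A + 1) by rewrite divr_gt0 // ltr_wpDl.
have [N1 h1] := truncation_cvg (g x) dA; have [N2 h2] := truncation_cvg (g y) dA.
apply: (LIMc _ _ _ (maxn N1 N2)) => // n; rewrite geq_max => /andP[n1 n2].
have PE : P n (i x) = h (truncation n (g x)).
  by congr (h (truncation n _)); apply/funext => k; rewrite phii.
have QE : Q n (j y) = h (truncation n (g y)).
  by congr (h (truncation n _)); apply/funext => k; rewrite psij.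
have Px : nm (P n (i x) - x) <= mh * (d / (A + 1)).
  rewrite PE -{2}(gK x) -linearB; apply: le_trans (hb _) _.
  by rewrite ler_wpM2l // h1.
have Qy : nm (Q n (j y) - y) <= mh * (d / (A + 1)).
  rewrite QE -{2}(gK y) -linearB; apply: le_trans (hb _) _.
  by rewrite ler_wpM2l // h2.
have -> : T (P n (i x)) (Q n (j y)) - T x y =
    T (P n (i x) - x) (Q n (j y)) + T x (Q n (j y) - y).
  by rewrite linearBl linearBr; ring.
have Qjy : nm (Q n (j y)) <= mh * mg * nm y.
  have jy : nm (j y) = nm y by rewrite /nm isoj.
  by rewrite -mulrA -jy; exact: Qb.
apply: le_trans (abD _ _ _) _; apply: le_trans (lerD (Tc _ _) (Tc _ _)) _.
set q := d / (A + 1) in Px Qy dA *.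
apply: (@le_trans _ _ (ct * (mh * q) * (mh * mg * nm y) + ct * nm x * (mh * q))).
  by apply: lerD; apply: ler_pM; rewrite ?mulr_ge0 ?nm_ge0 // ler_wpM2l.
apply: (@le_trans _ _ ((A + 1) * q)); last by rewrite /q mulrC divfK // gt_eqF
    // ltr_wpDl.
have -> : ct * (mh * q) * (mh * mg * nm y) + ct * nm x * (mh * q) =
  (ct * (mh * mg * nm y + nm x) * mh) * q by ring.
rewrite ler_pM2r // /A; apply: (@le_trans _ _ (ct * (mh * mg * nm y + nm x + 1)
    * (mh + 1))); last by rewrite lerDl.
apply: ler_pM; rewrite ?mulr_ge0 ?addr_ge0 ?mulr_ge0 ?nm_ge0 // ?lerDl //.
by rewrite ler_wpM2l // lerDl.
Qed.

End FormsOnC0.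

(** * The characterization of c_0 *)

Section Instances.
Variable R : realType.

Lemma real_scalars_scalarE (z : R) : z = idfun z + 0 * idfun (0 : R).
Proof. by rewrite mul0r addr0. Qed.

Lemma real_scalars_norm (z : R) : `|z| = idfun (Num.sqrt (z ^+ 2 + 0 ^+ 2)).
Proof. by rewrite expr0n addr0 sqrtr_sqr. Qed.

Definition real_scalars : scalars R R :=
  @Scalars R R idfun idfun (fun _ => 0) 0
    (fun _ _ => erefl) (fun _ _ => esym (addr0 0)) (fun _ _ => erefl)
    (fun r _ => esym (mulr0 r)) erefl erefl erefl
    real_scalars_scalarE real_scalars_norm (or_introl erefl).

Lemma complex_reZ (r : R) (z : R[i]) : complex.Re (real_complex R r * z) = r *
    complex.Re z.
Proof. by case: z => a b /=; rewrite mul0r subr0. Qed.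

Lemma complex_imZ (r : R) (z : R[i]) : complex.Im (real_complex R r * z) = r *
    complex.Im z.
Proof. by case: z => a b /=; rewrite mul0r addr0. Qed.

Definition complex_scalars : scalars R R[i].
Proof.
refine (@Scalars R R[i] (real_complex R) (@complex.Re R) (@complex.Im R) (Complex 0 1)
  _ _ complex_reZ complex_imZ erefl erefl erefl (@complexE R) (@normc_def R) _).
- by case=> a b [].
- by case=> a b [].
- by right; apply/eqP; rewrite eq_complex /= !mulr0 !mul0r sub0r mul1r addr0
    oppr0 !eqxx.
Defined.

End Instances.

Lemma all_forms_extendible_iff_c0 (R : realType) (K : numFieldType)
    (S : scalars R K) (X : completeNormedModType K) (e : nat -> X) :
  unconditional_basis e ->
  (forall T : {bilinear X -> X -> K^o}, continuous_bilinear T -> extendible T) <->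
  isomorphic X (c0 K).
Proof.
move=> /(unconditional_basis_system S)[e' [f [U us]]]; split.
  move=> /(unit_sums_bounded us)[B eB]; exact: isomorphic_c0 us eB.
exact: isomorphic_c0_extendible S _.
Qed.

Theorem theorem1p1 (R : realType) :
  (forall X : completeNormedModType R,
     infinite_dimensional X ->
     (exists e : nat -> X, unconditional_basis e) ->
     ((forall T : {bilinear X -> X -> R^o},
         continuous_bilinear T -> extendible T) <->
      isomorphic X (c0 R)))
  /\
  (forall X : completeNormedModType R[i],
     infinite_dimensional X ->
     (exists e : nat -> X, unconditional_basis e) ->
     ((forall T : {bilinear X -> X -> R[i]^o},
         continuous_bilinear T -> extendible T) <->
      isomorphic X (c0 R[i]))).
Proof.
split=> X _ [e /all_forms_extendible_iff_c0 eX].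
  exact: eX (real_scalars R).
exact: eX (complex_scalars R).
Qed.
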